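(* Let $G$ be an undirected graph with vertex set $V$, let $P_1,\dots,P_k$ be a perfect enumeration of its prime components with separators $S_2,\dots,S_k$, and let $(s,\alpha)$ be such that $I_G(s,\alpha)<\infty$. Then for all $\theta\in\mathbb{R}^{J}$ the conjugate prior can be written as the Markov ratio $$\pi_G(\theta|s,\alpha)=\frac{\prod_{l=1}^k\pi_{P_l}(\theta^{P_l}|s^{P_l},\alpha)}{\prod_{l=2}^k\pi_{S_l}(\theta^{S_l}|s^{S_l},\alpha)},$$ where, for $U\in\{P_1,\dots,P_k,S_2,\dots,S_k\}$, $$\pi_U(\theta^U|s^U,\alpha)=I_U(s^U,\alpha)^{-1}\exp\Big\{\sum_{D\in\mathcal{D}^U}\sum_{i_D\in\mathcal{I}_D^*}\theta_D^U(i_D)s(i_D)-\alpha\log\Big(1+\sum_{i\in\mathcal{I}_U,\,i\neq i_U^*}\exp\sum_{D\in\mathcal{D}^U,\ i_\gamma\neq0\,\forall\gamma\in D}\theta^U_D(i_D)\Big)\Big\}$$ is the conjugate prior for the $U$-marginal model, $s^U=(s(i_D))_{D\in\mathcal{D}^U,\,i_D\in\mathcal{I}_D^*}$. Moreover, the induced conjugate prior on the cell probabilities $p$ is the corresponding Markov ratio of the conjugate priors induced on $p^{P_l}$ and $p^{S_l}$: if $\theta$ has density $\pi_G(\cdot|s,\alpha)$ then $p^{P_l}$ (for $1\le l\le k$) and $p^{S_l}$ (for $2\le l\le k$) have the laws induced from $\pi_{P_l}(\cdot|s^{P_l},\alpha)$ and $\pi_{S_l}(\cdot|s^{S_l},\alpha)$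 respectively, and for each $l\ge2$, $p^{P_l}$ and $p^{P_1\cup\dots\cup P_{l-1}}$ are conditionally independent given $p^{S_l}$.
   Context: $V$ is a finite set. For each $\gamma\in V$, $\mathcal{I}_\gamma$ is a finite set of levels containing a distinguished level $0$. For $U\subseteq V$, $\mathcal{I}_U=\prod_{\gamma\in U}\mathcal{I}_\gamma$, $\mathcal{I}=\mathcal{I}_V$, $i^*=(0,\dots,0)\in\mathcal{I}$, $i_U=(i_\gamma)_{\gamma\in U}$; for $F\subseteq U$, $(i_F,i^*_{U\setminus F})\in\mathcal{I}_U$ equals $i_F$ on $F$ and $0$ on $U\setminus F$. $\mathcal{I}_E^*=\{i_E\in\mathcal{I}_E: i_\gamma\neq0\ \forall\gamma\in E\}$ for $E\ne\emptyset$. $\mathcal{D}$ is the set of nonempty complete subsets of $G$, $\mathcal{D}^U=\{D\in\mathcal{D}: D\subseteq U\}$, $J=\{(D,i_D): D\in\mathcal{D},\,i_D\in\mathcal{I}_D^*\}$, and $s\in\mathbb{R}^J$, $\alpha\in\mathbb{R}$. The prime components of $G$ are the maximal subsets of $V$ whose induced subgraph has no complete separator. A perfect enumeration $P_1,\dots,P_k$ is one such that for each $l\ge2$ the set $S_l=P_l\cap(P_1\cup\dots\cup P_{l-1})$ is complete (possibly empty), is contained in some $P_m$, $m<l$, and separates $P_l\setminus S_l$ from $(P_1\cup\dots\cup P_{l-1})\setminus S_l$ in $G_{P_1\cup\dots\cup P_l}$. For $\theta=(\theta_D(i_D))\in\mathbb{R}^J$ the cell probabilities are $$p(i)=\frac{\exp\sum_{D\in\mathcal{D},\,i_\gamma\ne0\,\forall\gamma\in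 D}\theta_D(i_D)}{1+\sum_{j\neq i^*}\exp\sum_{D\in\mathcal{D},\,j_\gamma\neq0\,\forall\gamma\in D}\theta_D(j_D)},\qquad i\in\mathcal{I},$$ and the conjugate prior is $$\pi_G(\theta|s,\alpha)=I_G(s,\alpha)^{-1}\exp\Big\{\sum_{(D,i_D)\in J}\theta_D(i_D)s(i_D)+\alpha\log p(i^* )\Big\},$$ with $I_G(s,\alpha)$ the integral of the exponential over $\mathbb{R}^J$. For $U\subseteq V$, $p^U=(p^U(i_U))_{i_U\in\mathcal{I}_U}$ with $p^U(i_U)=\sum_{j\in\mathcal{I},\,j_U=i_U}p(j)$ is the $U$-marginal table of cell probabilities. For $U$ a prime component or separator, $\theta^U=(\theta^U_D(i_D))_{D\in\mathcal{D}^U,\,i_D\in\mathcal{I}^*_D}$ is the log-linear parameter of the $U$-marginal: $$\theta^U_D(i_D)=\sum_{F\subseteq D}(-1)^{|D\setminus F|}\log p^U(i_F,i^*_{U\setminus F}).$$ $I_U(s^U,\alpha)$ is the normalising constant making $\pi_U(\cdot|s^U,\alpha)$ a probability density on the space of all real vectors indexed by $\{(D,i_D):D\in\mathcal{D}^U,i_D\in\mathcal{I}_D^*\}$ (if $U=\emptyset$, $\pi_U\equiv1$). The law induced on $p^U$ from $\pi_U$ is the law of the $U$-marginal table with log-linear parameter $\theta^U$ distributed according to $\pi_U$. *)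

(* Defs.v *)
From HB Require Import structures.
From mathcomp Require Import all_boot all_order all_algebra.
From mathcomp Require Import all_classical all_reals all_analysis.
Set Implicit Arguments.
Unset Strict Implicit.
Unset Printing Implicit Defensive.
Import Order.TTheory GRing.Theory Num.Theory.

Section graphs.
Variables (V : finType) (e : rel V).

Definition complete (D : {set V}) : bool :=
  [forall v in D, forall w in D, (v != w) ==> e v w].

(* [v] and [w] lie in different connected components of the subgraph induced
   on [W :\: C]; only used for [v] and [w] in [W :\: C]. *)
Definition separated (W C : {set V}) : rel V := fun v w =>
  ~~ connect [rel x y | [&& x \in W :\: C, y \in W :\: C & e x y]] v w.

Definition separates (W C A B : {set V}) : bool :=
  [forall v in A, forall w in B, separated W C v w].

(* The empty set is complete, so a set without complete separator is
   connected. *)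
Definition has_complete_separator (W : {set V}) : bool :=
  [exists C : {set V}, [&& C \subset W, complete C &
    [exists v in W :\: C, exists w in W :\: C, separated W C v w]]].

Definition prime_component (U : {set V}) : bool :=
  maxset (fun W => ~~ has_complete_separator W) U.

Section enumeration.
Variables (k : nat) (P : 'I_k -> {set V}).

(* With indices starting at 0, [history l] is the union of the components
   strictly before the one of index [l]; the separator [sep l] is relevant for
   [0 < l] only. *)
Definition history (l : 'I_k) : {set V} := \bigcup_(m < k | m < l) P m.

Definition sep (l : 'I_k) : {set V} := P l :&: history l.

Definition perfect_enumeration : Prop :=
  [/\ injective P,
      forall U : {set V}, prime_component U <-> exists l, P l = U
    & forall l : 'I_k, 0 < l ->
      [/\ complete (sep l),
          exists2 m : 'I_k, m < l & sep l \subset P m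
        & separates (history l :|: P l) (sep l)
            (P l :\: sep l) (history l :\: sep l)]].

End enumeration.
End graphs.

Local Open Scope classical_set_scope.
Local Open Scope ring_scope.

(* [n.-tuple R] carries the library sigma-algebra, generated by the coordinates;
   [lebesgue_tuple_box] below characterises the measure on it. *)
Section lebesgue_cons.
Variables (R : realType) (n : nat).
Variable mu : {sigma_finite_measure set (n.-tuple R) -> \bar R}.

Definition tuple_cons (x : measurableTypeR R * n.-tuple R) : n.+1.-tuple R :=
  [the n.+1.-tuple R of x.1 :: x.2].

Definition tuple_uncons (t : n.+1.-tuple R) :
    measurableTypeR R * n.-tuple R :=
  (tnth t ord0, [tuple of behead t]).

Lemma tuple_consK : cancel tuple_cons tuple_uncons.
Proof.
by case=> x t; congr pair; apply/val_inj.
Qed.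

Lemma measurable_tuple_cons : measurable_fun [set: measurableTypeR R * n.-tuple R] tuple_cons.
Proof. exact: measurable_cons. Qed.

Lemma measurable_tuple_uncons :
  measurable_fun [set: n.+1.-tuple R] tuple_uncons.
Proof.
apply/measurable_fun_pairP; split.
- exact: (measurable_tnth ord0).
- exact: measurable_behead.
Qed.

Definition lebesgue_cons : set (n.+1.-tuple R) -> \bar R :=
  pushforward (lebesgue_measure \x mu)%E tuple_cons.

HB.instance Definition _ := Measure.copy lebesgue_cons
  (measure_function_pushforward__canonical__measure_function_Measure
     (lebesgue_measure \x mu)%E measurable_tuple_cons).

Let lebesgue_cons_sigma_finite : sigma_finite setT lebesgue_cons.
Proof.
have /sigma_finiteP[F [FT Fnd Foo]] := sigma_finiteT (@lebesgue_measure R).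
have /sigma_finiteP[G [GT Gnd Goo]] := sigma_finiteT mu.
exists (fun k => tuple_uncons @^-1` (F k `*` G k)).
  rewrite -preimage_bigcup -(preimage_setT tuple_uncons); congr (_ @^-1` _).
  apply/esym/seteqP; split=> // -[x y] _.
  have [a _ Fa] : (\bigcup_k F k) x by rewrite -FT.
  have [b _ Gb] : (\bigcup_k G k) y by rewrite -GT.
  exists (maxn a b) => //; split => /=.
  - by move: x Fa; exact/subsetPset/Fnd/leq_maxl.
  - by move: y Gb; exact/subsetPset/Gnd/leq_maxr.
move=> k; have [mFk Fk] := Foo k; have [mGk Gk] := Goo k; split.
  rewrite -[X in measurable X]setTI; apply: measurable_tuple_uncons => //.
  exact: measurableX.
rewrite /lebesgue_cons /pushforward -comp_preimage.
rewrite (_ : tuple_uncons \o tuple_cons = id); last exact/funext/tuple_consK.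
by rewrite preimage_id product_measure1E// lte_mul_pinfty// ge0_fin_numE.
Qed.

HB.instance Definition _ := Measure_isSigmaFinite.Build _ _ _ lebesgue_cons
  lebesgue_cons_sigma_finite.

End lebesgue_cons.

Fixpoint lebesgue_tuple (R : realType) (n : nat) :
    {sigma_finite_measure set (n.-tuple R) -> \bar R} :=
  match n with
  | 0 => \d_ [tuple]
  | n'.+1 => lebesgue_cons (lebesgue_tuple R n')
  end.

Lemma lebesgue_tuple_box (R : realType) n (A : 'I_n -> set R) :
  (forall i, measurable (A i)) ->
  lebesgue_tuple R n [set t | forall i, A i (tnth t i)] =
  (\prod_(i < n) lebesgue_measure (A i))%E.
Proof.
elim: n A => [|n IH] A mA.
  by rewrite big_ord0 /= diracE mem_set => [|[]].
rewrite big_ord_recl -IH//; set B := [set t : n.-tuple R | _].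
have mB : measurable B.
  rewrite (_ : B = \bigcap_(i : 'I_n) (@tnth n R ^~ i @^-1` A (lift ord0 i))).
    apply: fin_bigcap_measurable => // i _.
    by rewrite -[X in measurable X]setTI; exact: (measurable_tnth i).
  by apply/seteqP; split=> t tA i; [move=> _; exact: tA|exact: (tA i)].
rewrite -product_measure1E//; last exact: mA.
change (lebesgue_cons (lebesgue_tuple R n)
    [set t | forall i, A i (tnth t i)] =
  (lebesgue_measure \x lebesgue_tuple R n)%E (A ord0 `*` B)).
rewrite /lebesgue_cons /pushforward; congr product_measure1.
apply/seteqP; split => -[x t] /=.
  move=> xA; split=> [|i] /=; first exact: (xA ord0).
  by have := xA (lift ord0 i); rewrite (tnthS x).
move=> [xA tB] i; have [j ->|-> //] := unliftP ord0 i.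
by rewrite (tnthS x); exact: tB.
Qed.

(* Vectors indexed by a finite type are tuples, read through the canonical
   enumeration of that type. *)
Notation vec R J := (#|{: J}|.-tuple R).

Section vectors.
Variables (R : realType) (J : finType).

Definition coord (x : vec R J) (j : J) : R := tnth x (enum_rank j).

Definition mkvec (f : J -> R) : vec R J := [tuple f (enum_val i) | i < #|{: J}|].

Lemma coord_mkvec f : coord (mkvec f) =1 f.
Proof. by move=> j; rewrite /coord tnth_mktuple enum_rankK. Qed.

Definition lebesgue_vec : {sigma_finite_measure set (vec R J) -> \bar R} :=
  lebesgue_tuple R #|{: J}|.

End vectors.

Section model.
Variables (R : realType) (V : finType) (L : V -> finType) (z : forall v, L v).
Variable e : rel V.

Definition cell := {dffun forall v, L v}.

Definition cell0 : cell := [ffun v => z v].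

(* For [U] a set of vertices, an element of the product of the [L v], [v] in
   [U], is represented by its extension by the level 0 outside [U]: the product
   is [cells U], [i_U] is [restr U i], and, for [F \subset U], the cell equal to
   [i] on [F] and to 0 on [U :\: F] is [restr F i]. *)
Definition cells (U : {set V}) : {set cell} :=
  [set i : cell | [forall (v | v \notin U), i v == z v]]%SET.

Definition restr (U : {set V}) (i : cell) : cell :=
  [ffun v => if v \in U then i v else z v].

Definition nonzero (D : {set V}) (i : cell) : bool :=
  [forall v in D, i v != z v].

Definition cells_star (D : {set V}) : {set cell} :=
  [set i in cells D | nonzero D i]%SET.

Definition cliques (U : {set V}) : {set {set V}} :=
  [set D : {set V} | [&& D != finset.set0, complete e D & D \subset U]]%SET.

(* The pairs [(D, i_D)], [D] in [cliques U] and [i_D] in [cells_star D]. The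
   model on all of [V] is the case [U = setT]. *)
Definition params (U : {set V}) : finType :=
  {x : {set V} * cell | (x.1 \in cliques U) && (x.2 \in cells_star x.1)}.

Definition entries (U : {set V}) : finType := {i : cell | i \in cells U}.

Section model_on_U.
Variable U : {set V}.
Implicit Types t sU : vec R (params U).

(* The coordinate of index [(D, i_D)]; the value 0 outside [params U] is never
   used. *)
Definition coef t (D : {set V}) (i : cell) : R :=
  if (insub (D, i) : option (params U)) is Some x then coord t x else 0.

Definition linpred t (i : cell) : R :=
  \sum_(D in cliques U | nonzero D i) coef t D (restr D i).

Definition expsum t : R :=
  \sum_(j in cells U | j != cell0) expR (linpred t j).

Definition prob t (i : cell) : R := expR (linpred t i) / (1 + expsum t).

Definition table t : vec R (entries U) := mkvec (fun i => prob t (val i)).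

Definition kernel_marg sU (alpha : R) t : R :=
  expR (\sum_(D in cliques U) \sum_(i in cells_star D) coef t D i * coef sU D i
        - alpha * ln (1 + expsum t)).

(* For [U] empty, [params U] is empty, [lebesgue_vec] is a unit point mass and
   [prior_marg] is constantly 1. An infinite constant would give density 0. *)
Definition normconst_marg sU (alpha : R) : \bar R :=
  (\int[lebesgue_vec R (params U)]_t (kernel_marg sU alpha t)%:E)%E.

Definition prior_marg sU (alpha : R) t : R :=
  (fine (normconst_marg sU alpha))^-1 * kernel_marg sU alpha t.

End model_on_U.

Implicit Types th s : vec R (params [set: V]%SET).

Definition marg th (U : {set V}) (i : cell) : R :=
  \sum_(j : cell | restr U j == i) prob th j.

Definition marg_table th (U : {set V}) : vec R (entries U) :=
  mkvec (fun i => marg th U (val i)).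

Definition marg_param th (U : {set V}) : vec R (params U) :=
  mkvec (fun x : params U => let: (D, i) := val x in
    \sum_(F : {set V} | F \subset D)
      (-1) ^+ #|D :\: F|%SET * ln (marg th U (restr F i))).

Definition sub_param s (U : {set V}) : vec R (params U) :=
  mkvec (fun x : params U => coef s (val x).1 (val x).2).

Definition kernel_full s (alpha : R) th : R :=
  expR (\sum_(x : params [set: V]%SET) coord th x * coord s x
        + alpha * ln (prob th cell0)).

Definition normconst_full s (alpha : R) : \bar R :=
  (\int[lebesgue_vec R (params [set: V]%SET)]_th (kernel_full s alpha th)%:E)%E.

Definition prior_full s (alpha : R) th : R :=
  (fine (normconst_full s alpha))^-1 * kernel_full s alpha th.

End model.

Section probability.
Variables (R : realType) (d : measure_display) (T : measurableType d).
Variable Pr : probability T R.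

Definition has_density (J : finType) (X : T -> vec R J) (f : vec R J -> R) :=
  forall A : set (vec R J), measurable A ->
    Pr (X @^-1` A) = (\int[lebesgue_vec R J]_(x in A) (f x)%:E)%E.

Section conditional.
Variables (d3 : measure_display) (T3 : measurableType d3) (Z : T -> T3).

(* [z |-> f z] is a version of the conditional probability [Pr (E | Z = z)];
   versions are unique almost everywhere for the law of [Z]. *)
Definition is_cond_prob (E : set T) (f : T3 -> R) : Prop :=
  measurable_fun [set: T3] f /\
  forall C : set T3, measurable C ->
    (\int[Pr]_(w in Z @^-1` C) (f (Z w))%:E)%E = Pr (E `&` Z @^-1` C).

(* For all [A] and [B], almost surely,
   [Pr (X \in A, Y \in B | Z) = Pr (X \in A | Z) * Pr (Y \in B | Z)]. *)
Definition cond_indep (d1 d2 : measure_display) (T1 : measurableType d1)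
    (T2 : measurableType d2) (X : T -> T1) (Y : T -> T2) : Prop :=
  forall (A : set T1) (B : set T2), measurable A -> measurable B ->
    exists f g : T3 -> R,
      [/\ is_cond_prob (X @^-1` A) f, is_cond_prob (Y @^-1` B) g
        & is_cond_prob (X @^-1` A `&` Y @^-1` B) (fun c => f c * g c)].

End conditional.
End probability.

(* Main.v *)
Require Import Defs.
From HB Require Import structures.
From mathcomp Require Import all_boot all_order all_algebra.
From mathcomp Require Import all_classical all_reals all_analysis.
From mathcomp Require Import measurable_realfun ring.
Set Implicit Arguments.
Unset Strict Implicit.
Unset Printing Implicit Defensive.
Import Order.TTheory GRing.Theory Num.Theory.
Local Open Scope classical_set_scope.
Local Open Scope ring_scope.

(** Let U be the union of A and B, with intersection S complete, and suppose
    that every clique of U lies in A or in B. Split the parameters of the model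
    on U into three blocks: a for the cliques of A outside S, b for those of B
    outside S, and c for those inside S. Summing the cell weights over the
    levels of B outside S yields a function of b and of i_S only; as S is
    complete, the logarithm of this function is, up to a constant h0_B(b), a sum
    of interactions h_B(b) that are parameters of the model on S
    ([margsum_add]). Hence the marginal on A is the log-linear model with
    parameters (a, c + h_B(b)), the marginal on B the one with parameters
    (b, c + h_A(a)), and the marginal on S the one with parameters
    sigma = c + h_A(a) + h_B(b).

    For fixed (a, b), the passage from c to sigma is a translation, so that
    (a, b, sigma) are coordinates that preserve Lebesgue measure and no Jacobian
    has to be computed ([integral_join], [integral_join_on]). In these
    coordinates the kernels of the conjugate priors factor:
    K_A = w_A(a) K_S(sigma), K_B = w_B(b) K_S(sigma) and
    K_U = w_A(a) w_B(b) K_S(sigma) ([kernel_join], [kernel_join_on]), because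
    the linear part of the exponent is additive and the partition sum of A is
    exp(h0_A(a)) times that of S.

    Everything follows from this product form ([integral_decomposition]). With
    C_A and C_B the integrals of w_A and w_B, the normalising constants are
    I_A = C_A I_S, I_B = C_B I_S and I_U = C_A C_B I_S; all factors are positive,
    so they are finite when I_U is. The density on U is the product of those on
    A and B divided by that on S ([prior_factor]); the marginal laws on A, B and
    S are the priors of the corresponding models ([consistent_left],
    [consistent_sep]); and a, b, sigma are independent, while the tables on A, B
    and S are functions of (a, sigma), (b, sigma) and sigma, the last one
    injective. This gives the conditional independence
    ([cond_indep_tables]).

    In a perfect enumeration, the union of the first l components is decomposed
    in this way by its last component and the union of the preceding ones
    ([clique_in_part]). Starting from V and removing the components from the
    last to the first proves all assertions. *)

Local Notation coord := Defs.coord.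

(** * Lebesgue measure on indexed vectors *)

Section lebesgue_tuple.
Variable R : realType.

Lemma measurable_tuple_box n (A : 'I_n -> set R) :
  (forall i, measurable (A i)) ->
  measurable [set t : n.-tuple R | forall i, A i (tnth t i)].
Proof.
move=> mA.
rewrite (_ : mkset _ = \bigcap_(i : 'I_n) (@tnth n R ^~ i @^-1` A i)).
  apply: fin_bigcap_measurable => // i _.
  by rewrite -[X in measurable X]setTI; exact: (measurable_tnth i).
by apply/seteqP; split=> t tA i; [move=> _; exact: tA|exact: (tA i)].
Qed.

(** Boxes form a pi-system that generates the sigma-algebra, and countably
    many boxes of finite measure cover the space. *)
Lemma lebesgue_tuple_unique n (m : {measure set (n.-tuple R) -> \bar R}) :
  (forall A : 'I_n -> set R, (forall i, measurable (A i)) ->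
    m [set t | forall i, A i (tnth t i)] =
    (\prod_(i < n) lebesgue_measure (A i))%E) ->
  forall X, measurable X -> lebesgue_tuple R n X = m X.
Proof.
move=> mE X mX.
have /sigma_finiteP[F [FT Fnd Foo]] := sigma_finiteT (@lebesgue_measure R).
(* The measurable boxes. *)
pose G : set (set (n.-tuple R)) := [set B | exists2 A : 'I_n -> set R,
  (forall i, measurable (A i)) & B = [set t | forall i, A i (tnth t i)]].
apply: (measure_unique G (fun k => [set t | forall i, F k (tnth t i)])) => //.
- apply/seteqP; split; last first.
    apply: smallest_sub; first exact: sigma_algebra_measurable.
    by move=> _ [A mA ->]; exact: measurable_tuple_box.
  apply: smallest_sub; first exact: smallest_sigma_algebra.
  case: n => [|n] in m mE X mX G *; first by rewrite big_ord0.
  rewrite -bigcup_mkord_ord; apply: bigcup_sub => j _ B [C mC <-].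
  apply: sub_sigma_algebra.
  exists (fun i => if i == inord j then C else setT).
    by move=> i; case: ifP.
  apply/seteqP; split=> t /=.
    by move=> [_ tC] i; case: eqP => // ->.
  by move=> /(_ (inord j)); rewrite eqxx; split.
- move=> _ _ [A mA ->] [B mB ->]; exists (fun i => A i `&` B i).
    by move=> i; exact: measurableI.
  apply/seteqP; split=> t /=; first by move=> [tA tB] i; split.
  by move=> tAB; split=> i; have [] := tAB i.
- move=> k; exists (fun=> F k) => // i; exact: (Foo k).1.
- apply/seteqP; split=> // t _.
  have Ft (i : 'I_n) : exists k, F k (tnth t i).
    have : setT (tnth t i) by [].
    by rewrite FT => -[k _ ?]; exists k.
  pose K i := projT1 (cid (Ft i)).
  exists (\max_(i < n) K i)%N => // i.
  apply: (subsetPset _ _ (Fnd _ _ (leq_bigmax i))).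
  by rewrite /K; case: cid.
- by move=> _ [A mA ->]; rewrite mE//; exact: lebesgue_tuple_box.
- move=> k; rewrite /= (@lebesgue_tuple_box R n (fun=> F k)); last first.
    by move=> _; exact: (Foo k).1.
  rewrite -ge0_fin_numE; last by apply: prode_ge0 => i _; exact: measure_ge0.
  by apply: prode_fin_num => i _; rewrite ge0_fin_numE//; exact: (Foo k).2.
Qed.

End lebesgue_tuple.

Lemma lebesgue_translation (R : realType) (a : R) (A : set R) :
  measurable A ->
  lebesgue_measure ((fun x => x + a) @^-1` A) = lebesgue_measure A.
Proof.
move=> mA.
have mf : measurable_fun setT ((fun x => x + a) : R -> measurableTypeR R).
  exact: measurable_funD.
apply/esym.
pose m := measure_function_pushforward__canonical__measure_function_Measure
     (@lebesgue_measure R) mf.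
apply: (@lebesgue_measure_unique R m) => //= _ [[b c]] _ <-.
rewrite /pushforward /= (_ : _ @^-1` _ = `]b - a, c - a]%classic); last first.
  by apply/seteqP; split=> x /=; rewrite !in_itv/= ltrBlDr lerBrDr.
by rewrite !lebesgue_measure_itv/= !lte_fin ltrD2r -!EFinB opprB addrA subrK.
Qed.

Section lebesgue_vec.
Variables (R : realType) (J : finType).

Lemma measurable_coord (j : J) :
  measurable_fun setT (fun t : vec R J => coord t j).
Proof. exact: measurable_tnth. Qed.

Lemma measurable_mkvec d (T : measurableType d) (f : T -> J -> R) :
  (forall j, measurable_fun setT (fun w => f w j)) ->
  measurable_fun setT (fun w => mkvec (f w)).
Proof.
move=> mf; apply/measurable_fun_tnthP => i.
rewrite (_ : _ \o _ = fun w => f w (enum_val i)); first exact: mf.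
by apply/funext => w /=; rewrite tnth_mktuple.
Qed.

Lemma mkvecK (t : vec R J) : mkvec (coord t) = t.
Proof. by apply: eq_from_tnth => i; rewrite tnth_mktuple /coord enum_valK. Qed.

Lemma box_coordE (A : J -> set R) :
  [set t : vec R J | forall j, A j (coord t j)] =
  [set t | forall i, A (enum_val i) (tnth t i)].
Proof.
apply/seteqP; split=> t /= tA j.
  by have := tA (enum_val j); rewrite /coord enum_valK.
by have := tA (enum_rank j); rewrite enum_rankK.
Qed.

Lemma measurable_box (A : J -> set R) : (forall j, measurable (A j)) ->
  measurable [set t : vec R J | forall j, A j (coord t j)].
Proof.
move=> mA; rewrite box_coordE.
by apply: (measurable_tuple_box (A := A \o enum_val)) => i; exact: mA.
Qed.

Lemma lebesgue_vec_box (A : J -> set R) : (forall j, measurable (A j)) ->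
  lebesgue_vec R J [set t | forall j, A j (coord t j)] =
  (\prod_j lebesgue_measure (A j))%E.
Proof.
move=> mA; rewrite box_coordE (lebesgue_tuple_box (A := A \o enum_val)); last by move=> i; exact: mA.
by rewrite -(big_enum_val (fun j => lebesgue_measure (A j))).
Qed.

Lemma lebesgue_vec_unique (m : {measure set (vec R J) -> \bar R}) :
  (forall A : J -> set R, (forall j, measurable (A j)) ->
    m [set t | forall j, A j (coord t j)] =
    (\prod_j lebesgue_measure (A j))%E) ->
  forall X, measurable X -> lebesgue_vec R J X = m X.
Proof.
move=> mE; move=> X; apply: lebesgue_tuple_unique => A mA.
have := mE (A \o enum_rank) (fun=> mA _).
rewrite (box_coordE (A \o enum_rank)).
rewrite (_ : mkset _ = [set t | forall i, A i (tnth t i)]); last first.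
  by apply/seteqP; split=> t /= tA i; have := tA i; rewrite /= enum_valK.
move=> ->; rewrite (big_enum_val (fun j => lebesgue_measure (A (enum_rank j)))).
by apply: eq_bigr => i _; rewrite enum_valK.
Qed.

(** The translated measure gives boxes the right mass, by translation
    invariance on the line. *)
Lemma lebesgue_vec_translation (u : J -> R) (F : vec R J -> \bar R) :
  measurable_fun setT F -> (forall t, 0 <= F t)%E ->
  (\int[lebesgue_vec R J]_t F t =
   \int[lebesgue_vec R J]_t F (mkvec (fun j => coord t j + u j)%R))%E.
Proof.
move=> mF F0.
have mf : measurable_fun setT (fun t : vec R J => mkvec (fun j => coord t j + u j)).
  apply: measurable_mkvec => j; apply: measurable_funD => //.
  exact: measurable_coord.
pose m := measure_function_pushforward__canonical__measure_function_Measure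
     (lebesgue_vec R J) mf.
transitivity (\int[m]_t F t)%E; last first.
  by rewrite ge0_integral_pushforward//; move=> x _; exact: F0.
apply: eq_measure_integral => X mX _.
apply: lebesgue_vec_unique mX => A mA; rewrite /= /pushforward.
rewrite (_ : _ @^-1` _ =
    [set t | forall j, ((fun x => x + u j) @^-1` A j) (coord t j)]); last first.
  by apply/seteqP; split=> t /= tA j; have := tA j; rewrite coord_mkvec.
rewrite (lebesgue_vec_box (A := fun j => (fun x => x + u j) @^-1` A j)); last first.
  move=> j; rewrite -[X in measurable X]setTI.
  by apply: (measurable_funD (f := id) (g := cst (u j))).
by apply: eq_bigr => j _; exact: lebesgue_translation.
Qed.

End lebesgue_vec.

(** * Vectors indexed by subsets of a common index type *)

Section subvectors.
Variables (R : realType) (X : finType).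
Implicit Types Q : pred X.

Definition subfin Q : finType := {x : X | Q x}.

(** Extension by zero turns vectors over different index sets into functions on
    one type, which can be added and compared. *)
Definition ext Q (t : vec R (subfin Q)) (x : X) : R :=
  if (insub x : option (subfin Q)) is Some y then coord t y else 0.

(** Restriction, the left inverse of [ext]. *)
Definition pack Q (f : X -> R) : vec R (subfin Q) := mkvec (fun y => f (val y)).

Lemma ext_pack Q f x : ext (pack Q f) x = if Q x then f x else 0.
Proof.
rewrite /ext; case: insubP => [y -> <-|/negbTE -> //].
by rewrite coord_mkvec.
Qed.

Lemma ext_out Q (t : vec R (subfin Q)) x : ~~ Q x -> ext t x = 0.
Proof. by rewrite /ext => nQ; rewrite insubN. Qed.

Lemma ext_val Q (t : vec R (subfin Q)) (y : subfin Q) : ext t (val y) = coord t y.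
Proof. by rewrite /ext valK. Qed.

Lemma eq_pack Q f g : (forall x, Q x -> f x = g x) -> pack Q f = pack Q g.
Proof. by move=> fg; congr mkvec; apply/funext => y; exact/fg/(valP y). Qed.

Lemma extK Q : cancel (@ext Q) (pack Q).
Proof.
move=> t; rewrite -[RHS]mkvecK; congr mkvec; apply/funext => y.
exact: ext_val.
Qed.

Lemma measurable_ext Q x :
  measurable_fun setT (fun t : vec R (subfin Q) => ext t x).
Proof.
rewrite /ext; case: insubP => [y _ _|_]; last exact: measurable_cst.
exact: measurable_coord.
Qed.

Lemma measurable_pack Q d (T : measurableType d) (f : T -> X -> R) :
  (forall x, Q x -> measurable_fun setT (fun w => f w x)) ->
  measurable_fun setT (fun w => pack Q (f w)).
Proof. by move=> mf; apply: measurable_mkvec => y; exact/mf/(valP y). Qed.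

Definition merge Q Q1 Q2 (t1 : vec R (subfin Q1)) (t2 : vec R (subfin Q2)) :
  vec R (subfin Q) := pack Q (fun x => ext t1 x + ext t2 x).

Definition splits Q Q1 Q2 :=
  forall x, Q x = Q1 x || Q2 x /\ ~~ (Q1 x && Q2 x).

Lemma ext_merge Q Q1 Q2 (t1 : vec R (subfin Q1)) (t2 : vec R (subfin Q2)) x :
  splits Q Q1 Q2 -> ext (merge Q t1 t2) x = ext t1 x + ext t2 x.
Proof.
move=> sQ; rewrite ext_pack; have [-> _] := sQ x.
by case: ifPn => //; rewrite negb_or => /andP[? ?]; rewrite !ext_out// addr0.
Qed.

Lemma measurable_merge Q Q1 Q2 :
  measurable_fun setT (fun t : vec R (subfin Q1) * vec R (subfin Q2) => merge Q t.1 t.2).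
Proof.
apply: (measurable_pack (f := fun t x => ext t.1 x + ext t.2 x)) => x _.
apply: measurable_funD.
  exact: (measurableT_comp (@measurable_ext Q1 x) measurable_fst).
exact: (measurableT_comp (@measurable_ext Q2 x) measurable_snd).
Qed.

(** Tonelli along a partition of the coordinates: the image of the product
    measure under [merge] gives boxes the right mass. *)
Lemma lebesgue_vec_split Q Q1 Q2 (F : vec R (subfin Q) -> \bar R) :
  splits Q Q1 Q2 -> measurable_fun setT F -> (forall t, 0 <= F t)%E ->
  (\int[lebesgue_vec R (subfin Q)]_t F t =
   \int[lebesgue_vec R (subfin Q1)]_t1 \int[lebesgue_vec R (subfin Q2)]_t2
     F (merge Q t1 t2))%E.
Proof.
move=> sQ mF F0.
pose m := measure_function_pushforward__canonical__measure_function_Measure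
  (lebesgue_vec R (subfin Q1) \x lebesgue_vec R (subfin Q2))%E
  (@measurable_merge Q Q1 Q2).
transitivity (\int[m]_t F t)%E; last first.
  have -> := @ge0_integral_pushforward _ _ _ _ _ _ (@measurable_merge Q Q1 Q2)
    (lebesgue_vec R (subfin Q1) \x lebesgue_vec R (subfin Q2))%E _ F measurableT mF
    (fun x _ => F0 x).
  rewrite fubini_tonelli1//.
    exact: measurableT_comp mF (@measurable_merge Q Q1 Q2).
  by move=> t; exact: F0.
apply: eq_measure_integral => Y mY _.
rewrite -[LHS]/(lebesgue_vec R (subfin Q) Y).
rewrite (@lebesgue_vec_unique R (subfin Q) m _ Y mY)// => A mA; rewrite /= /pushforward.
(* Coordinates outside Q carry no constraint. *)
pose B x := if (insub x : option (subfin Q)) is Some y then A y else setT.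
have mB x : measurable (B x) by rewrite /B; case: insub.
rewrite (_ : _ @^-1` _ =
    [set t | forall y, B (val y) (coord t y)] `*`
    [set t | forall y, B (val y) (coord t y)]); last first.
  apply/seteqP; split=> -[t1 t2] /=.
    move=> tA; split=> y; rewrite /B; case: insubP => // u _ uy;
      have := tA u; rewrite -(ext_val _ u) ext_merge// uy ext_val.
      have [_] := sQ (val y); rewrite (valP y) /= => Q2y.
      by rewrite (ext_out t2)// addr0.
    have [_] := sQ (val y); rewrite (valP y) andbT => Q1y.
    by rewrite (ext_out t1)// add0r.
  move=> [t1B t2B] y; rewrite -(ext_val _ y) ext_merge//.
  have [QE Qd] := sQ (val y); have := valP y; rewrite QE => /orP[] Qy.
    move: Qd; rewrite Qy /= => Q2y; rewrite (ext_out t2)// addr0.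
    by have := t1B (Sub (val y) Qy); rewrite -ext_val SubK /B valK.
  move: Qd; rewrite Qy andbT => Q1y; rewrite (ext_out t1)// add0r.
  by have := t2B (Sub (val y) Qy); rewrite -ext_val SubK /B valK.
have subE Q' : (\prod_(y : subfin Q') lebesgue_measure (B (val y)) =
    \prod_(x | Q' x) lebesgue_measure (B x))%E.
  by rewrite (big_sub Q' (fun x => lebesgue_measure (B x))).
have boxE Q' : lebesgue_vec R (subfin Q')
    [set t | forall y, B (val y) (coord t y)] =
    (\prod_(x | Q' x) lebesgue_measure (B x))%E.
  by have -> := @lebesgue_vec_box R (subfin Q') (B \o val) (fun=> mB _).
rewrite product_measure1E; [|exact: (@measurable_box R (subfin Q1) (B \o val) (fun=> mB _))
  |exact: (@measurable_box R (subfin Q2) (B \o val) (fun=> mB _))].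
transitivity (\prod_(x | Q1 x) lebesgue_measure (B x) *
    \prod_(x | Q2 x) lebesgue_measure (B x))%E.
  by congr (_ * _)%E; exact: boxE.
rewrite [RHS](eq_bigr (fun y : subfin Q => lebesgue_measure (B (val y)))); last first.
  by move=> y _; rewrite /B valK.
rewrite subE [RHS](bigID Q1)/=; congr (_ * _)%E; apply: eq_bigl => x;
  by have [->] := sQ x; case: (Q1 x); case: (Q2 x).
Qed.

Lemma lebesgue_subvec_translation Q (u : X -> R) (F : vec R (subfin Q) -> \bar R) :
  measurable_fun setT F -> (forall t, 0 <= F t)%E ->
  (\int[lebesgue_vec R (subfin Q)]_t F t =
   \int[lebesgue_vec R (subfin Q)]_t F (pack Q (ext t \+ u)%R))%E.
Proof.
move=> mF F0; rewrite (lebesgue_vec_translation (u \o val) mF F0).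
apply: eq_integral => t _; congr F; congr mkvec; apply/funext => y /=.
by rewrite ext_val.
Qed.

End subvectors.

(** * Moebius inversion over subsets *)

Section moebius.
Variables (R : realType) (V : finType).
Implicit Types (D F U : {set V}) (f g h : {set V} -> R).

(** The sign-reversing involution behind the cancellations in alternating sums
    over subsets. *)
Definition toggle (v : V) D : {set V} :=
  (if v \in D then D :\ v else v |: D)%SET.

Lemma toggleK v : involutive (toggle v).
Proof.
move=> D; rewrite /toggle; case: (boolP (v \in D)) => vD.
  by rewrite setD11 finset.setD1K.
by rewrite setU11 setU1K.
Qed.

Lemma sum_toggle v (P : pred {set V}) f :
  (forall D, P (toggle v D) = P D) ->
  (forall D, P D -> f (toggle v D) = - f D) -> \sum_(D | P D) f D = 0.
Proof.
move=> tP tf; set S := \sum_(D | _) _.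
have /eqP : S + S = 0; last by rewrite -mulr2n mulrn_eq0 => /eqP.
rewrite {1}/S (reindex_inj (inv_inj (toggleK v)))/= (eq_bigl _ _ tP).
by rewrite -big_split/= big1// => D PD; rewrite tf// addNr.
Qed.

Lemma sub_toggle v F D : v \notin F -> (F \subset toggle v D)%SET = (F \subset D)%SET.
Proof.
move=> vF; rewrite /toggle; case: ifP => vD; apply/idP/idP => sF.
- exact: fintype.subset_trans sF (finset.subsetDl _ _).
- by rewrite finset.subsetD1 sF.
- apply/fintype.subsetP => x xF; have := fintype.subsetP sF x xF.
  by rewrite !inE => /orP[/eqP xv|//]; rewrite -xv xF in vF.
- exact: fintype.subset_trans sF (finset.subsetUr _ _).
Qed.

Lemma toggle_sub v U D : v \in U -> (toggle v D \subset U)%SET = (D \subset U)%SET.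
Proof.
move=> vU; rewrite /toggle; case: ifP => vD.
  have /finset.setUidPr vUE : ([set v] \subset U)%SET by rewrite finset.sub1set.
  by rewrite finset.subDset vUE.
by rewrite finset.subUset finset.sub1set vU.
Qed.

Lemma signr_toggle v F D : v \notin F ->
  (-1) ^+ #|toggle v D :\: F|%SET = - (-1) ^+ #|D :\: F|%SET :> R.
Proof.
move=> vF; rewrite /toggle; case: ifPn => vD.
  rewrite [in RHS](cardsD1 v) !inE vD vF/= exprS mulN1r opprK.
  by congr (_ ^+ #|pred_of_set _|); apply/setP => x; rewrite !inE andbCA.
rewrite [in LHS](cardsD1 v) !inE eqxx vF/= exprS mulN1r; congr (- _ ^+ #|pred_of_set _|).
apply/setP => x; rewrite !inE; case: eqVneq => [->|_] //=.
by rewrite (negbTE vD) andbF.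
Qed.

Lemma signr_toggleC v F D : v \in D ->
  (-1) ^+ #|D :\: toggle v F|%SET = - (-1) ^+ #|D :\: F|%SET :> R.
Proof.
move=> vD; rewrite /toggle; case: ifPn => vF.
  rewrite [in LHS](cardsD1 v) !inE eqxx vD/= exprS mulN1r.
  congr (- _ ^+ #|pred_of_set _|).
  apply/setP => x; rewrite !inE; case: eqVneq => [->|_] //=.
  by rewrite vF.
rewrite [in RHS](cardsD1 v) !inE vD vF/= exprS mulN1r opprK.
by congr (_ ^+ #|pred_of_set _|); apply/setP => x; rewrite !inE negb_or andbA.
Qed.

Definition moebius g D : R :=
  \sum_(F : {set V} | F \subset D) (-1) ^+ #|D :\: F|%SET * g F.

Lemma moebiusK g U : \sum_(D : {set V} | D \subset U) moebius g D = g U.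
Proof.
rewrite /moebius (exchange_big_dep (fun F : {set V} => F \subset U))/=; last first.
  by move=> D F DU FD; exact: fintype.subset_trans FD DU.
rewrite (bigD1 U)//= [X in _ + X]big1 => [|F /andP[FU FnU]].
  rewrite addr0.
  rewrite (bigD1 U) ?fintype.subxx//= big1 => [|D /andP[/andP[DU UD]]].
    by rewrite finset.setDv cards0 expr0 mul1r addr0.
  by rewrite finset.eqEsubset DU UD.
have /subsetPn[v vU vF] : ~~ (U \subset F).
  by apply: contra FnU => UF; rewrite finset.eqEsubset FU UF.
apply: (sum_toggle (v := v)) => D; first by rewrite toggle_sub// sub_toggle.
by rewrite signr_toggle// mulNr.
Qed.

Lemma moebius_sumK h D : moebius (fun F => \sum_(E : {set V} | E \subset F) h E) D = h D.
Proof.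
rewrite /moebius; under eq_bigr do rewrite mulr_sumr.
rewrite (exchange_big_dep (fun F : {set V} => F \subset D))/=; last first.
  by move=> F E FD EF; exact: fintype.subset_trans EF FD.
rewrite (bigD1 D)//= [X in _ + X]big1 => [|F /andP[FD FnD]].
  rewrite addr0 (bigD1 D) ?fintype.subxx//= big1 => [|E /andP[/andP[ED DE]]].
    by rewrite finset.setDv cards0 expr0 mul1r addr0.
  by rewrite finset.eqEsubset ED DE.
have /subsetPn[v vD vF] : ~~ (D \subset F).
  by apply: contra FnD => DF; rewrite finset.eqEsubset FD DF.
apply: (sum_toggle (v := v)) => E; first by rewrite toggle_sub// sub_toggle.
by rewrite signr_toggleC// mulNr.
Qed.

(** This is why the interaction at (D, i) vanishes when i has a zero level
    in D: the restrictions of i then ignore that vertex. *)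
Lemma moebius_eq0 g D v : v \in D -> (forall F, F \subset D -> g (toggle v F) = g F) ->
  moebius g D = 0.
Proof.
move=> vD gv; apply: (sum_toggle (v := v)) => F; first by rewrite toggle_sub.
by move=> FD; rewrite signr_toggleC// gv// mulNr.
Qed.

End moebius.

(** * Log-linear potentials on cells and their marginal sums *)

Section loglinear.
Variables (R : realType) (V : finType) (L : V -> finType) (z : forall v, L v).
Implicit Types (D F U W A B S : {set V}) (i j : cell L).

Local Notation index := ({set V} * cell L)%type.
Local Notation cells := (cells z).
Local Notation restr := (restr z).
Local Notation nonzero := (nonzero z).
Local Notation cells_star := (cells_star z).
Local Notation cell0 := (cell0 z).

Lemma restr_cells U i : restr U i \in cells U.
Proof. by rewrite inE; apply/forall_inP => v vU; rewrite ffunE (negbTE vU). Qed.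

Lemma restr_id U i : i \in cells U -> restr U i = i.
Proof.
rewrite inE => /forall_inP iU; apply/ffunP => v; rewrite ffunE.
by case: ifPn => // /iU /eqP ->.
Qed.

Lemma restr_restr U W i : restr U (restr W i) = restr (U :&: W) i.
Proof. by apply/ffunP => v; rewrite !ffunE inE; case: (v \in U). Qed.

Lemma cellsS U W i : U \subset W -> i \in cells U -> i \in cells W.
Proof.
rewrite !inE => /fintype.subsetP UW /forall_inP iU; apply/forall_inP => v vW.
by apply: iU; apply: contra vW; exact: UW.
Qed.

Lemma cellsT i : i \in cells [set: V]%SET.
Proof. by rewrite inE; apply/forall_inP => v; rewrite inE. Qed.

Lemma cell0_cells U : cell0 \in cells U.
Proof. by rewrite inE; apply/forall_inP => v _; rewrite ffunE. Qed.

Lemma restr_set0 i : restr finset.set0 i = cell0.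
Proof. by apply/ffunP => v; rewrite !ffunE inE. Qed.

Lemma nonzero_restr D U i :
  nonzero D (restr U i) = (D \subset U) && nonzero D i.
Proof.
apply/forall_inP/andP => [nz|[/fintype.subsetP DU /forall_inP nz] v vD].
  split; last by apply/forall_inP => v vD; have := nz v vD; rewrite ffunE;
    case: ifP => //; rewrite eqxx.
  apply/fintype.subsetP => v vD; have := nz v vD; rewrite ffunE.
  by case: ifP => //; rewrite eqxx.
by rewrite ffunE DU//; exact: nz.
Qed.

Lemma restr_star D i : (restr D i \in cells_star D) = nonzero D i.
Proof. by rewrite inE restr_cells/= nonzero_restr fintype.subxx. Qed.

Lemma starP D i : i \in cells_star D -> restr D i = i /\ nonzero D i.
Proof. by rewrite inE => /andP[/restr_id]. Qed.

Definition supported (Y : Type) (c : {set V} * Y -> R) U :=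
  forall x : {set V} * Y, ~~ (x.1 \subset U) -> c x = 0.

(** The logarithm of the unnormalised cell weight. Once parameters are extended
    by zero, the linear predictors of all marginal models are instances of this
    one function, which is additive in the parameters. *)
Definition linpot (c : index -> R) i : R :=
  \sum_(D : {set V} | (D != finset.set0) && nonzero D i) c (D, restr D i).

Lemma linpotD c c' i : linpot (c \+ c') i = linpot c i + linpot c' i.
Proof. by rewrite /linpot -big_split. Qed.

Lemma eq_linpot c c' : c =1 c' -> linpot c =1 linpot c'.
Proof. by move=> cc i; apply: eq_bigr => D _; rewrite cc. Qed.

Lemma linpot0 c : linpot c cell0 = 0.
Proof.
rewrite /linpot big1// => D /andP[/set0Pn[v vD] /forall_inP/(_ v vD)].
by rewrite ffunE eqxx.
Qed.

Lemma linpot_restr c A i : supported c A -> linpot c (restr A i) = linpot c i.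
Proof.
move=> cA; rewrite /linpot [RHS](bigID (fun D => D \subset A))/= [X in _ + X]big1.
  rewrite addr0; apply: eq_big => D.
    by rewrite nonzero_restr -andbA [X in _ && X]andbC.
  rewrite nonzero_restr => /and3P[_ DA _].
  by rewrite restr_restr (finset.setIidPl DA).
by move=> D /andP[_ DA]; exact: cA.
Qed.

(** The constant [k] stands for the logarithm of a normalisation, which enters
    the empty interaction only. *)
Lemma moebius_linpot k c D i : i \in cells_star D -> D != finset.set0 ->
  moebius (fun F => k + linpot c (restr F i)) D = c (D, i).
Proof.
move=> iD D0.
pose h E : R := if E == finset.set0 then k else c (E, restr E i).
have [riD /forall_inP nz] := starP iD.
rewrite -[RHS](_ : h D = _); last by rewrite /h (negbTE D0) riD.
rewrite -(moebius_sumK h D); apply: eq_bigr => F FD; congr (_ * _).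
rewrite (bigD1 finset.set0) ?finset.sub0set//=; congr (_ + _).
  by rewrite /h eqxx.
apply: eq_big => E.
  rewrite nonzero_restr; case: (boolP (E \subset F)) => EF; rewrite ?andbF//=.
  rewrite (_ : nonzero E i) ?andbT//; apply/forall_inP => v vE; apply: nz.
  by apply: (fintype.subsetP (fintype.subset_trans EF FD)).
rewrite nonzero_restr => /and3P[E0 EF _].
by rewrite /h (negbTE E0) restr_restr (finset.setIidPl EF).
Qed.

Definition interaction S (q : cell L -> R) (x : index) : R :=
  if [&& x.1 != finset.set0, x.1 \subset S & x.2 \in cells_star x.1]
  then moebius (fun F => q (restr F x.2)) x.1 else 0.

Lemma interaction_supported S q : supported (interaction S q) S.
Proof. by move=> x /negbTE xS; rewrite /interaction xS andbF. Qed.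

(** Any function on the cells of S is log-linear when all interactions inside S
    are admitted; the empty one is the value at the zero cell. *)
Lemma linpot_interaction S q i : i \in cells S ->
  q i = q cell0 + linpot (interaction S q) i.
Proof.
move=> iS; rewrite -{1}(restr_id iS) -(moebiusK (fun F => q (restr F i))).
rewrite (bigD1 finset.set0) ?finset.sub0set//=; congr (_ + _).
  rewrite /moebius (big_pred1 finset.set0) => [|F].
    by rewrite finset.setDv cards0 expr0 mul1r restr_set0.
  by rewrite finset.subset0.
rewrite (bigID (fun D => nonzero D i))/= [X in _ + X]big1.
  rewrite addr0 /linpot [RHS](bigID (fun D => D \subset S))/= [X in _ + X]big1.
    rewrite addr0; apply: eq_big => D; first by case: (D \subset S); rewrite ?andbT ?andbF.
    move=> /andP[/andP[DS D0] nz].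
    rewrite /interaction /= D0 DS restr_star nz/=; apply: eq_bigr => F FD.
    by rewrite restr_restr (finset.setIidPl FD).
  by move=> D /andP[_ DS]; exact: interaction_supported.
move=> D /andP[/andP[DS D0] /forall_inPn[v vD /negPn/eqP iv]].
apply: (moebius_eq0 vD) => F FD; congr q; apply/ffunP => w; rewrite !ffunE.
have [->|wv] := eqVneq w v; first by rewrite iv !if_same.
rewrite /toggle; case: (v \in F); by rewrite !inE ?wv// (negbTE wv).
Qed.

Definition margsum U W (f : cell L -> R) i : R :=
  \sum_(j in cells U | restr W j == i) f j.

Lemma eq_margsum U W f g i : f =1 g -> margsum U W f i = margsum U W g i.
Proof. by move=> fg; apply: eq_bigr => j _. Qed.

Lemma margsum_scale U W f (k : R) i :
  margsum U W (fun j => k * f j) i = k * margsum U W f i.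
Proof. by rewrite /margsum mulr_sumr. Qed.

Lemma margsum_gt0 U W f i : W \subset U -> (forall j, 0 < f j) ->
  i \in cells W -> 0 < margsum U W f i.
Proof.
move=> WU f0 iW; rewrite /margsum (bigD1 i)/=; last first.
  by rewrite (cellsS WU iW) restr_id ?eqxx.
by rewrite ltr_pwDl// sumr_ge0// => j _; exact: ltW.
Qed.

Lemma margsum_total U W f :
  \sum_(i in cells W) margsum U W f i = \sum_(j in cells U) f j.
Proof.
rewrite [RHS](partition_big (restr W) (mem (cells W)))//.
by move=> j _; exact: restr_cells.
Qed.

Lemma margsum_trans U W1 W f i : W \subset W1 -> i \in cells W ->
  margsum U W f i = margsum W1 W (margsum U W1 f) i.
Proof.
move=> WW1 iW; rewrite /margsum.
rewrite (partition_big (restr W1) (mem (cells W1)))/=; last first.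
  by move=> j _; exact: restr_cells.
rewrite [LHS](bigID (fun j => restr W j == i))/= [X in _ + X]big1 ?addr0.
  apply: eq_bigr => j /andP[_ /eqP ji]; apply: eq_bigl => j'.
  rewrite -andbA; congr andb; case: (restr W1 j' =P j) => [E|]; rewrite ?andbF// andbT.
  by rewrite -ji -E restr_restr (finset.setIidPl WW1) eqxx.
move=> j /andP[_ ji]; rewrite big_pred0// => j'; apply/negbTE.
apply: contra ji => /andP[/andP[_ /eqP <-] /eqP <-].
by rewrite restr_restr (finset.setIidPl WW1).
Qed.

Definition glue A i j : cell L := [ffun v => if v \in A then i v else j v].

(** A cell of the union that restricts to [i] on A is [i] glued to a cell of B
    that agrees with [i] on S. *)
Lemma margsum_glue U A B S (f g : cell L -> R) i :
  (A :|: B = U)%SET -> (A :&: B = S)%SET ->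
  (forall j, f (restr A j) = f j) -> (forall j, g (restr B j) = g j) ->
  i \in cells A ->
  margsum U A (f \* g) i = f i * margsum B S g (restr S i).
Proof.
move=> <- <- fA gB iA; rewrite /margsum mulr_sumr.
rewrite (reindex_onto (glue A i) (restr B))/=; last first.
  move=> j /andP[jU /eqP <-]; apply/ffunP => v; rewrite !ffunE.
  case: (boolP (v \in A)) => vA //; case: (boolP (v \in B)) => vB //.
  have : v \notin (A :|: B)%SET by rewrite inE negb_or vA vB.
  by move: jU; rewrite inE => /forall_inP jU /jU /eqP.
have rA j : restr A (glue A i j) = i.
  rewrite -[RHS](restr_id iA); apply/ffunP => v; rewrite !ffunE.
  by case: (v \in A).
apply: eq_big => j.
  rewrite rA eqxx andbT; apply/andP/andP => [[jU /eqP jB]|[jB /eqP jS]].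
    split; first by rewrite -jB restr_cells.
    apply/eqP; rewrite -jB restr_restr; apply/ffunP => v; rewrite !ffunE !inE.
    by case: (v \in A); case: (v \in B).
  split.
    rewrite inE; apply/forall_inP => v; rewrite inE negb_or => /andP[vA vB].
    rewrite ffunE (negbTE vA).
    by move: jB; rewrite inE => /forall_inP; exact.
  apply/eqP/ffunP => v; rewrite -[in RHS](restr_id jB) !ffunE.
  case: ifP => // vB; case: ifP => // vA.
  by move/ffunP/(_ v) : jS; rewrite !ffunE !inE vA vB.
move=> /andP[_ /eqP jB]; rewrite -fA rA; congr (_ * _).
by rewrite -gB jB.
Qed.

End loglinear.

(** * Parameters of marginal models *)

Section hierarchical_model.
Variables (R : realType) (V : finType) (L : V -> finType) (z : forall v, L v).
Variable e : rel V.
Implicit Types (D F U W A B S : {set V}) (i j : cell L).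

Local Notation index := ({set V} * cell L)%type.
Local Notation cells := (cells z).
Local Notation restr := (restr z).
Local Notation cell0 := (cell0 z).
Local Notation linpot := (linpot z).
Local Notation margsum := (margsum z).

(** The indices of [params] as a predicate on one type, so that the index sets of
    different models can be compared. *)
Definition par U : pred index :=
  fun x => (x.1 \in cliques e U) && (x.2 \in cells_star z x.1).

Local Notation pvec U := (vec R (subfin (par U))).

Lemma parP U D i : par U (D, i) ->
  [/\ D != finset.set0, complete e D, D \subset U & i \in cells_star z D].
Proof. by rewrite /par /= inE => /andP[/and3P[]]. Qed.

Lemma par_sub U W x : U \subset W -> par U x -> par W x.
Proof.
case: x => D i UW /parP[D0 cD DU iD]; rewrite /par/= inE D0 cD iD.
by rewrite (fintype.subset_trans DU UW).
Qed.

Lemma ext_supported U (t : pvec U) : supported (ext t) U.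
Proof.
move=> x xU; apply: ext_out; apply: contra xU.
by case: x => D i /parP[].
Qed.

Definition partition_sum U (c : index -> R) : R := \sum_(j in cells U) expR (linpot c j).

Lemma partition_sum_gt0 U c : 0 < partition_sum U c.
Proof.
rewrite /partition_sum (bigD1 cell0) ?cell0_cells//= ltr_pwDl ?expR_gt0//.
by rewrite sumr_ge0// => j _; exact: expR_ge0.
Qed.

Section original_definitions.
Variables (U : {set V}) (t : vec R (params z e U)).

Let c : index -> R := ext (t : pvec U).

Lemma coef_ext D i : coef t D i = c (D, i).
Proof. by []. Qed.

Lemma linpredE i : linpred t i = linpot c i.
Proof.
rewrite /linpred /linpot [RHS](bigID (fun D => D \in cliques e U))/= [X in _ + X]big1.
  rewrite addr0; apply: eq_big => D; last by rewrite coef_ext.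
  rewrite [in RHS]andbC andbA; congr andb; rewrite inE.
  by case: (D != _); rewrite ?andbF ?andbT.
move=> D /andP[_ DU]; apply: ext_out; apply: contra DU.
by rewrite /par => /andP[].
Qed.

Lemma expsumE : 1 + expsum t = partition_sum U c.
Proof.
rewrite /partition_sum (bigD1 cell0) ?cell0_cells//= linpot0 expR0; congr (_ + _).
by apply: eq_bigr => j _; rewrite linpredE.
Qed.

Lemma probE i : prob t i = expR (linpot c i) / partition_sum U c.
Proof. by rewrite /prob expsumE linpredE. Qed.

Lemma kernel_margE (sU : vec R (params z e U)) alpha :
  kernel_marg sU alpha t =
  expR (\sum_x c x * ext (sU : pvec U) x - alpha * ln (partition_sum U c)).
Proof.
rewrite /kernel_marg expsumE; congr expR; congr (_ - _).
rewrite pair_big_dep/= [RHS](bigID (par U))/= [X in _ + X]big1 ?addr0.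
  by apply: eq_big => [[D i]|[D i] _] //=; rewrite !coef_ext.
by move=> x xU; rewrite /c (ext_out (t : pvec U) xU) mul0r.
Qed.

End original_definitions.

(** The interactions h_B of the weights summed over the levels outside S;
    [logsum0] is the constant h0_B. *)
Definition logsum_coef B S (c : index -> R) : index -> R :=
  interaction z S (fun i => ln (margsum B S (expR \o linpot c) i)).

Definition logsum0 B S (c : index -> R) : R :=
  ln (margsum B S (expR \o linpot c) cell0).

Lemma logsum_coef_supported B S c : supported (logsum_coef B S c) S.
Proof. exact: interaction_supported. Qed.

(** Nonempty subsets of a complete set are cliques, so all interactions of the
    summed weights are parameters of the model on S. *)
Lemma logsum_coef_par B S c x : complete e S -> ~~ par S x -> logsum_coef B S c x = 0.
Proof.
case: x => D i /forall_inP cS; rewrite /logsum_coef /interaction /par/= inE.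
case: ifP => // /and3P[D0 DS iD]; rewrite D0 DS iD !andbT/= => /negP[].
apply/forall_inP => v vD; apply/forall_inP => w wD.
have /forall_inP := cS v (fintype.subsetP DS v vD); apply.
exact: (fintype.subsetP DS).
Qed.

Lemma margsum_logsum B S c i : S \subset B -> i \in cells S ->
  margsum B S (expR \o linpot c) i = expR (logsum0 B S c + linpot (logsum_coef B S c) i).
Proof.
move=> SB iS; rewrite /logsum0 /logsum_coef.
rewrite -(linpot_interaction (fun i => ln (margsum B S (expR \o linpot c) i)) iS).
by rewrite lnK// posrE margsum_gt0// => j; exact: expR_gt0.
Qed.

Section add.
Variables (U A B S : {set V}) (c c' : index -> R).
Hypotheses (hU : (A :|: B = U)%SET) (hS : (A :&: B = S)%SET).
Hypotheses (cA : supported c A) (cB : supported c' B).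

(** Summing out B outside S multiplies the weights on A by a function of i_S,
    that is, translates the parameters by a vector that lives on S. *)
Lemma margsum_add i : i \in cells A ->
  margsum U A (expR \o linpot (c \+ c')) i =
  expR (logsum0 B S c' + linpot (c \+ logsum_coef B S c') i).
Proof.
move=> iA.
rewrite (@eq_margsum _ _ _ _ _ _ _ ((expR \o linpot c) \* (expR \o linpot c'))); last first.
  by move=> j /=; rewrite linpotD expRD.
rewrite (margsum_glue hU hS)//; last 2 first.
- by move=> j /=; rewrite linpot_restr.
- by move=> j /=; rewrite linpot_restr.
rewrite margsum_logsum ?restr_cells//; last by rewrite -hS finset.subsetIr.
rewrite linpot_restr; last exact: logsum_coef_supported.
by rewrite /= -expRD linpotD addrCA.
Qed.

Lemma partition_sum_add : partition_sum U (c \+ c') =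
  expR (logsum0 B S c') * partition_sum A (c \+ logsum_coef B S c').
Proof.
rewrite /partition_sum -(margsum_total z U A) mulr_sumr; apply: eq_bigr => i iA.
by rewrite -expRD; exact: margsum_add.
Qed.

End add.

(** The log-linear parameters of the W-marginal of the model on U. Weights may be
    left unnormalised: a constant factor enters the empty interaction only. *)
Definition margpar U W (t : pvec U) : pvec W :=
  pack (par W) (fun x =>
    moebius (fun F => ln (margsum U W (expR \o linpot (ext t)) (restr F x.2))) x.1).

Lemma margparE U W (t : pvec U) k c :
  (forall i, i \in cells W -> margsum U W (expR \o linpot (ext t)) i = expR (k + linpot c i)) ->
  margpar W t = pack (par W) c.
Proof.
move=> tE; apply: eq_pack => -[D i] /parP[D0 _ DW iD] /=.
rewrite -(moebius_linpot k c iD D0); apply: eq_bigr => F FD; congr (_ * _).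
rewrite tE ?expRK//; apply: cellsS (restr_cells _ _ _).
exact: fintype.subset_trans FD DW.
Qed.

End hierarchical_model.

(** * Measurability in the parameters *)

Section measurability.
Variables (R : realType) (V : finType) (L : V -> finType) (z : forall v, L v).
Variables (d : measure_display) (T : measurableType d).

Local Notation index := ({set V} * cell L)%type.

Lemma measurable_sum_cond (I : Type) (r : seq I) (P : pred I) (f : I -> T -> R) :
  (forall i, P i -> measurable_fun setT (f i)) ->
  measurable_fun setT (fun w => \sum_(i <- r | P i) f i w).
Proof.
move=> mf; under eq_fun do rewrite big_mkcond.
apply: (@measurable_sum _ _ _ _ _ r (fun i w => if P i then f i w else 0)) => i.
by case: (boolP (P i)) => Pi; [exact: mf|exact: measurable_cst].
Qed.

Variable c : T -> index -> R.
Hypothesis mc : forall x, measurable_fun setT (fun w => c w x).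

Lemma measurable_linpot i : measurable_fun setT (fun w => linpot z (c w) i).
Proof. by apply: measurable_sum_cond => D _; exact: mc. Qed.

Lemma measurable_margsum U W i :
  measurable_fun setT (fun w => margsum z U W (expR \o linpot z (c w)) i).
Proof.
apply: measurable_sum_cond => j _.
exact: measurableT_comp (@measurable_expR R) (measurable_linpot j).
Qed.

Lemma measurable_partition_sum U : measurable_fun setT (fun w => partition_sum z U (c w)).
Proof.
apply: measurable_sum_cond => j _.
exact: measurableT_comp (@measurable_expR R) (measurable_linpot j).
Qed.

Lemma measurable_ln_margsum U W i :
  measurable_fun setT (fun w => ln (margsum z U W (expR \o linpot z (c w)) i)).
Proof. exact: measurableT_comp (@measurable_ln R) (measurable_margsum U W i). Qed.

Lemma measurable_moebius U W D i : measurable_fun setT (fun w =>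
  moebius (fun F => ln (margsum z U W (expR \o linpot z (c w)) (restr z F i))) D).
Proof.
apply: measurable_sum_cond => F _; apply: measurable_funM => //.
exact: measurable_ln_margsum.
Qed.

Lemma measurable_logsum_coef U W x : measurable_fun setT (fun w => logsum_coef z U W (c w) x).
Proof.
rewrite /logsum_coef /interaction.
set b := [&& _, _ & _]; case: b; last exact: measurable_cst.
exact: measurable_moebius.
Qed.

End measurability.

(** * Fibre coordinates over a separator *)

Section decomposition.
Variables (R : realType) (V : finType) (L : V -> finType) (z : forall v, L v).
Variable e : rel V.
Implicit Types (D F U W A B S : {set V}) (i j : cell L).
Variables (s : {set V} * cell L -> R) (alpha : R).

Local Notation index := ({set V} * cell L)%type.
Local Notation linpot := (linpot z).
Local Notation par := (par z e).
Local Notation pvec U := (vec R (subfin (par U))).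

Definition model_kernel U (c : index -> R) : R :=
  expR (\sum_x c x * s x - alpha * ln (partition_sum z U c)).

Lemma measurable_kernel U : measurable_fun setT (fun t : pvec U => model_kernel U (ext t)).
Proof.
apply: (measurableT_comp (@measurable_expR R)); apply: measurable_funB.
  apply: measurable_sum => x; apply: measurable_funM => //.
  exact: measurable_ext.
apply: measurable_funM => //; apply: (measurableT_comp (@measurable_ln R)).
by apply: measurable_partition_sum => x; exact: measurable_ext.
Qed.

(** The coordinates along the fibres of the map from models on A to their
    marginals on S. *)
Definition resid A S : pred index := fun x => par A x && ~~ par S x.
Local Notation rvec A S := (vec R (subfin (resid A S))).

Lemma resid_supported A S (a : rvec A S) : supported (ext a) A.
Proof.
move=> x xA; apply: ext_out; apply: contra xA.
by case: x => D i /andP[/parP[]].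
Qed.

Definition shift A S (a : rvec A S) : index -> R := logsum_coef z A S (ext a).

(** The model on A with fibre coordinates [a] and S-marginal [sg]: the shift
    undoes the translation of [margsum_add]. *)
Definition join A S (a : rvec A S) (sg : pvec S) : pvec A :=
  pack (par A) ((ext sg \- shift a) \+ ext a).

(** The factor of the kernel on A that is constant in the S-marginal. *)
Definition weight A S (a : rvec A S) : R :=
  expR (\sum_x (ext a x - shift a x) * s x - alpha * logsum0 z A S (ext a)).

Lemma measurable_weight A S : measurable_fun setT (@weight A S).
Proof.
apply: (measurableT_comp (@measurable_expR R)); apply: measurable_funB.
  apply: measurable_sum => x; apply: measurable_funM => //.
  apply: measurable_funB; first exact: measurable_ext.
  by apply: measurable_logsum_coef => y; exact: measurable_ext.
apply: measurable_funM => //.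
by apply: measurable_ln_margsum => y; exact: measurable_ext.
Qed.

Lemma measurable_shift A S d (T : measurableType d) (f : T -> rvec A S) x :
  measurable_fun setT f -> measurable_fun setT (fun w => shift (f w) x).
Proof.
move=> mf; apply: measurable_logsum_coef => y.
exact: measurableT_comp (@measurable_ext _ _ _ y) mf.
Qed.

Lemma measurable_join A S :
  measurable_fun setT (fun t : rvec A S * pvec S => join t.1 t.2).
Proof.
apply: (measurable_pack (f := fun t => (ext t.2 \- shift t.1) \+ ext t.1)) => x _.
apply: measurable_funD; last first.
  exact: (measurableT_comp (@measurable_ext _ _ _ x) measurable_fst).
apply: measurable_funB.
  exact: (measurableT_comp (@measurable_ext _ _ _ x) measurable_snd).
by apply: measurable_shift; exact: measurable_fst.
Qed.

Section fiber.
Variables A S : {set V}.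
Hypotheses (SA : S \subset A) (cS : complete e S).

Lemma splits_resid : splits (par A) (resid A S) (par S).
Proof.
move=> x; rewrite /resid; split; last by case: (par S x); rewrite ?andbF.
by have := @par_sub V L z e S A x SA; case: (par S x); rewrite ?orbT ?orbF ?andbT// => ->.
Qed.

Lemma shift_par (a : rvec A S) x : ~~ par S x -> shift a x = 0.
Proof. exact: logsum_coef_par. Qed.

Lemma ext_join (a : rvec A S) (sg : pvec S) :
  ext (join a sg) = (ext sg \- shift a) \+ ext a.
Proof.
apply/funext => x; rewrite ext_pack; case: ifPn => // xA.
have xS : ~~ par S x by apply: contra xA; exact: par_sub.
rewrite /= !ext_out//; last by rewrite /resid negb_and xA.
by rewrite shift_par// subrr addr0.
Qed.

Lemma shifted_supported (a : rvec A S) (sg : pvec S) : supported (ext sg \- shift a) S.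
Proof. by move=> x xS /=; rewrite ext_supported// /shift logsum_coef_supported// subrr. Qed.

Lemma margsum_join (a : rvec A S) (sg : pvec S) i : i \in cells z S ->
  margsum z A S (expR \o linpot (ext (join a sg))) i =
  expR (logsum0 z A S (ext a) + linpot (ext sg) i).
Proof.
move=> iS; rewrite (ext_join a sg).
rewrite (margsum_add (finset.setUidPr SA) (finset.setIidPl SA))//.
- by congr (expR (_ + _)); apply: eq_linpot => x /=; rewrite subrK.
- exact: shifted_supported.
- exact: resid_supported.
Qed.

Lemma margpar_join (a : rvec A S) (sg : pvec S) : margpar S (join a sg) = sg.
Proof.
rewrite (@margparE _ _ _ _ _ _ _ _ (logsum0 z A S (ext a)) (ext sg)) ?extK// => i iS.
exact: margsum_join.
Qed.

Lemma partition_sum_join (a : rvec A S) (sg : pvec S) :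
  partition_sum z A (ext (join a sg)) =
  expR (logsum0 z A S (ext a)) * partition_sum z S (ext sg).
Proof.
rewrite ext_join (partition_sum_add z (finset.setUidPr SA) (finset.setIidPl SA))//.
- congr (_ * _); congr partition_sum; apply/funext => x /=.
  by rewrite subrK.
- exact: shifted_supported.
- exact: resid_supported.
Qed.

(** The shift enters the exponent linearly, and the partition sum splits by
    [partition_sum_join]. *)
Lemma kernel_join (a : rvec A S) (sg : pvec S) :
  model_kernel A (ext (join a sg)) = weight a * model_kernel S (ext sg).
Proof.
rewrite /model_kernel partition_sum_join lnM ?posrE ?expR_gt0 ?partition_sum_gt0// expRK ext_join.
rewrite -expRD; congr expR; rewrite mulrDr opprD [RHS]addrACA -big_split/=.
congr (_ + _); apply: eq_bigr => x _; rewrite -mulrDl; congr (_ * _).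
by rewrite addrC addrA addrAC.
Qed.

End fiber.
End decomposition.

(** * Integration in fibre coordinates *)

Section fiber_integral.
Variables (R : realType) (V : finType) (L : V -> finType) (z : forall v, L v).
Variable e : rel V.
Variables (s : {set V} * cell L -> R) (alpha : R).
Implicit Types (A B S U : {set V}).

Local Notation par := (par z e).
Local Notation pvec U := (vec R (subfin (par U))).
Local Notation resid := (resid z e).
Local Notation rvec A S := (vec R (subfin (resid A S))).
Local Notation weight := (weight s alpha).
Local Notation kern := (model_kernel z s alpha).

Local Open Scope ereal_scope.

(** For fixed fibre coordinates, [join] is a translation in the remaining
    ones. *)
Lemma integral_join A S (F : pvec A -> \bar R) :
  S \subset A -> complete e S ->
  measurable_fun setT F -> (forall t, 0 <= F t) ->
  \int[lebesgue_vec R (subfin (par A))]_t F t =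
  \int[lebesgue_vec R (subfin (par S))]_sg
    \int[lebesgue_vec R (subfin (resid A S))]_a F (join a sg).
Proof.
move=> SA cS mF F0.
rewrite (lebesgue_vec_split (splits_resid z e SA) mF F0).
have mFj : measurable_fun setT (fun x : rvec A S * pvec S => F (join x.1 x.2)).
  exact: measurableT_comp mF (@measurable_join _ _ _ _ _ _ _).
transitivity (\int[lebesgue_vec R (subfin (resid A S))]_a
    \int[lebesgue_vec R (subfin (par S))]_sg F (join a sg)); last first.
  exact: (fubini_tonelli _ mFj (fun x => F0 (join x.1 x.2))).
apply: eq_integral => a _.
have mFa : measurable_fun setT (fun sg : pvec S => F (merge (par A) a sg)).
  apply: (measurableT_comp mF).
  exact: measurableT_comp (@measurable_merge _ _ _ _ _) (measurable_pair1 a).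
rewrite (lebesgue_subvec_translation (fun x => - shift a x)%R mFa (fun=> F0 _)).
apply: eq_integral => sg _; congr F; apply: eq_pack => x _ /=.
rewrite addrC ext_pack; case: ifPn => //= xS.
by rewrite (ext_out sg)// shift_par// subrr.
Qed.

(** The unnormalised expectation along the fibre over [sg]. *)
Definition fiberint A S (phi : pvec A -> \bar R) (sg : pvec S) : \bar R :=
  \int[lebesgue_vec R (subfin (resid A S))]_a (phi (join a sg) * (weight a)%:E).

Lemma fiberint_ge0 A S (phi : pvec A -> \bar R) (sg : pvec S) :
  (forall t, 0 <= phi t) -> 0 <= fiberint phi sg.
Proof.
by move=> phi0; apply: integral_ge0 => a _; rewrite mule_ge0// lee_fin expR_ge0.
Qed.

Lemma measurable_fiber A S (phi : pvec A -> \bar R) :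
  measurable_fun setT phi -> measurable_fun setT
    (fun x : pvec S * rvec A S => phi (join x.2 x.1) * (weight x.2)%:E).
Proof.
move=> mphi; apply: emeasurable_funM.
  apply: (measurableT_comp mphi).
  have mswap : measurable_fun setT (fun x : pvec S * rvec A S => (x.2, x.1)).
    exact: measurable_swap.
  by have := measurableT_comp (@measurable_join R V L z e A S) mswap; exact.
apply/measurable_EFinP.
have msnd : measurable_fun setT (fun x : pvec S * rvec A S => x.2).
  exact: measurable_snd.
by have := measurableT_comp (@measurable_weight R V L z e s alpha A S) msnd; exact.
Qed.

Lemma measurable_fiberint A S (phi : pvec A -> \bar R) :
  measurable_fun setT phi -> (forall t, 0 <= phi t) ->
  measurable_fun setT (fun sg : pvec S => fiberint phi sg).
Proof.
move=> mphi phi0.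
have f0 (x : pvec S * rvec A S) : 0 <= phi (join x.2 x.1) * (weight x.2)%:E.
  by rewrite mule_ge0// lee_fin expR_ge0.
exact: (measurable_fun_fubini_tonelli_F
  (m2 := lebesgue_vec R (subfin (resid A S))) _ (measurable_fiber mphi) f0).
Qed.

Lemma measurable_ekernel U : measurable_fun setT (fun t : pvec U => (kern U (ext t))%:E).
Proof. by apply/measurable_EFinP; exact: measurable_kernel. Qed.

Lemma kernel_ge0 U c : 0 <= (kern U c)%:E.
Proof. by rewrite lee_fin expR_ge0. Qed.

Lemma integral_kernel_fiber A S (phi : pvec A -> \bar R) :
  S \subset A -> complete e S ->
  measurable_fun setT phi -> (forall t, 0 <= phi t) ->
  \int[lebesgue_vec R (subfin (par A))]_t (phi t * (kern A (ext t))%:E) =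
  \int[lebesgue_vec R (subfin (par S))]_sg
    ((kern S (ext sg))%:E * fiberint phi sg).
Proof.
move=> SA cS mphi phi0; rewrite (@integral_join A S)//; last first.
- by move=> t; rewrite mule_ge0// kernel_ge0.
- by apply: emeasurable_funM => //; exact: measurable_ekernel.
apply: eq_integral => sg _; rewrite -ge0_integralZl//.
- by apply: eq_integral => a _; rewrite kernel_join// EFinM muleA muleC.
- exact: measurableT_comp (measurable_fiber mphi) (measurable_pair1 sg).
- by move=> a _; rewrite mule_ge0// lee_fin expR_ge0.
- exact: kernel_ge0.
Qed.

Section decomposition.
Variables U A B S : {set V}.
Hypotheses (hU : (A :|: B = U)%SET) (hS : (A :&: B = S)%SET).
Hypothesis cS : complete e S.
Hypothesis cliquesU : forall D, D \in cliques e U -> D \subset A \/ D \subset B.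

Let SA : S \subset A. Proof. by rewrite -hS finset.subsetIl. Qed.
Let SB : S \subset B. Proof. by rewrite -hS finset.subsetIr. Qed.
Let AU : A \subset U. Proof. by rewrite -hU finset.subsetUl. Qed.
Let BU : B \subset U. Proof. by rewrite -hU finset.subsetUr. Qed.

(** A clique of U not contained in A is contained in B, and not in S, as S is
    contained in A. *)
Lemma splits_decomposition : splits (par U) (resid B S) (par A).
Proof.
move=> x; have xAU := par_sub AU (x := x); have xBU := par_sub BU (x := x).
rewrite /resid; split; last first.
  apply/negP => /andP[/andP[xB /negP xS] xA]; apply: xS.
  case: x xB xA {xAU xBU} => D i /parP[D0 cD DB iD] /parP[_ _ DA _].
  by rewrite /par /= inE D0 cD iD -hS finset.subsetI DA DB.
apply/idP/orP => [xU|[/andP[/xBU//]|/xAU//]].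
case: (boolP (par A x)) => [_|xA]; [by right|left].
case: x xU xA {xAU xBU} => D i /[dup] /parP[D0 cD DU iD] /andP[/= DUc _].
have parE W : par W (D, i) = (D \subset W) by rewrite /par/= inE D0 cD iD andbT.
rewrite !parE => DA.
have [|DB] := cliquesU DUc; first by rewrite (negbTE DA).
by rewrite DB; apply: contra DA => DS; exact: fintype.subset_trans DS SA.
Qed.

(** The analogue of [join] over A instead of S: the cliques of B outside A are
    those outside S. *)
Definition join_on (t : pvec A) (b : rvec B S) : pvec U :=
  pack (par U) ((ext t \- shift b) \+ ext b)%R.

Lemma join_on_merge (t : pvec A) (b : rvec B S) :
  join_on t b = merge (par U) b (pack (par A) (ext t \- shift b)%R).
Proof.
apply: eq_pack => x _ /=; rewrite [RHS]addrC ext_pack; case: ifPn => // xA.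
have xS : ~~ par S x by apply: contra xA; exact: par_sub.
by rewrite (ext_out t)// shift_par// subrr.
Qed.

Lemma ext_join_on (t : pvec A) (b : rvec B S) :
  ext (join_on t b) = ((ext t \- shift b) \+ ext b)%R.
Proof.
apply/funext => x; rewrite join_on_merge ext_merge; last exact: splits_decomposition.
rewrite ext_pack addrC; case: ifPn => //= xA.
have xS : ~~ par S x by apply: contra xA; exact: par_sub.
by rewrite (ext_out t)// shift_par// subrr.
Qed.

Lemma join_on_supported (t : pvec A) (b : rvec B S) : supported (ext t \- shift b)%R A.
Proof.
move=> x xA /=; rewrite ext_supported// /shift logsum_coef_supported ?subrr//.
by apply: contra xA => xS; exact: fintype.subset_trans xS SA.
Qed.

Lemma join_on_subK (t : pvec A) (b : rvec B S) :
  ((ext t \- shift b) \+ logsum_coef z B S (ext b))%R = ext t.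
Proof. by apply/funext => x /=; rewrite subrK. Qed.

Lemma margsum_join_on (t : pvec A) (b : rvec B S) i : i \in cells z A ->
  margsum z U A (expR \o linpot z (ext (join_on t b))) i =
  expR (logsum0 z B S (ext b) + linpot z (ext t) i).
Proof.
move=> iA; rewrite ext_join_on (margsum_add hU hS)//.
- by rewrite join_on_subK.
- exact: join_on_supported.
- exact: resid_supported.
Qed.

Lemma margpar_join_on (t : pvec A) (b : rvec B S) : margpar A (join_on t b) = t.
Proof.
rewrite (@margparE _ _ _ _ _ _ _ _ (logsum0 z B S (ext b)) (ext t)) ?extK// => i iA.
exact: margsum_join_on.
Qed.

Lemma kernel_join_on (t : pvec A) (b : rvec B S) :
  kern U (ext (join_on t b)) = (weight b * kern A (ext t))%R.
Proof.
rewrite /model_kernel ext_join_on (partition_sum_add z hU hS); last 2 first.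
- exact: join_on_supported.
- exact: resid_supported.
rewrite join_on_subK lnM ?posrE ?expR_gt0 ?partition_sum_gt0// expRK.
rewrite -expRD; congr expR; rewrite mulrDr opprD [RHS]addrACA -big_split/=.
congr (_ + _)%R; apply: eq_bigr => x _; rewrite -mulrDl; congr (_ * _)%R.
by rewrite addrC addrA addrAC.
Qed.

Lemma measurable_join_on :
  measurable_fun setT (fun x : pvec A * rvec B S => join_on x.1 x.2).
Proof.
apply: (measurable_pack
  (f := fun x : pvec A * rvec B S => (ext x.1 \- shift x.2) \+ ext x.2)%R) => y _.
apply: measurable_funD; last first.
  exact: (measurableT_comp (@measurable_ext _ _ _ y) measurable_snd).
apply: measurable_funB.
  exact: (measurableT_comp (@measurable_ext _ _ _ y) measurable_fst).
by apply: measurable_shift; exact: measurable_snd.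
Qed.

Lemma integral_join_on (F : pvec U -> \bar R) :
  measurable_fun setT F -> (forall t, 0 <= F t) ->
  \int[lebesgue_vec R (subfin (par U))]_t F t =
  \int[lebesgue_vec R (subfin (par S))]_sg
    \int[lebesgue_vec R (subfin (resid B S))]_b
      \int[lebesgue_vec R (subfin (resid A S))]_a F (join_on (join a sg) b).
Proof.
move=> mF F0; rewrite (lebesgue_vec_split splits_decomposition mF F0).
pose f (x : rvec B S * pvec S) :=
  \int[lebesgue_vec R (subfin (resid A S))]_a F (join_on (join a x.2) x.1).
have mf : measurable_fun setT f.
  pose g (y : (rvec B S * pvec S) * rvec A S) := F (join_on (join y.2 y.1.2) y.1.1).
  have mg : measurable_fun setT g.
    have m1 : measurable_fun setT (fun y : (rvec B S * pvec S) * rvec A S => (y.2, y.1.2)).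
      apply/measurable_fun_pairP; split; first exact: measurable_snd.
      exact: (measurableT_comp measurable_snd measurable_fst).
    have m2 : measurable_fun setT
        (fun y : (rvec B S * pvec S) * rvec A S => (join y.2 y.1.2, y.1.1)).
      apply/measurable_fun_pairP; split.
        exact: (measurableT_comp (@measurable_join R V L z e A S) m1).
      exact: (measurableT_comp measurable_fst measurable_fst).
    exact: (measurableT_comp mF (measurableT_comp measurable_join_on m2)).
  exact: (measurable_fun_fubini_tonelli_F
    (m2 := lebesgue_vec R (subfin (resid A S))) g mg (fun=> F0 _)).
have f0 x : 0 <= f x by apply: integral_ge0 => a _; exact: F0.
transitivity (\int[lebesgue_vec R (subfin (resid B S))]_b
    \int[lebesgue_vec R (subfin (par S))]_sg f (b, sg)); last first.
  exact: (fubini_tonelli f mf f0).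
apply: eq_integral => b _.
have mFm : measurable_fun setT (fun t : pvec A => F (merge (par U) b t)).
  apply: (measurableT_comp mF).
  exact: measurableT_comp (@measurable_merge _ _ _ _ _) (measurable_pair1 b).
rewrite (lebesgue_subvec_translation (fun x => - shift b x)%R mFm (fun=> F0 _)).
under eq_integral do rewrite -join_on_merge.
rewrite (@integral_join A S (fun t => F (join_on t b)))//.
apply: (measurableT_comp mF).
exact: measurableT_comp measurable_join_on (measurable_pair2 b).
Qed.

End decomposition.

(** The coordinates (a, b, sigma) are symmetric in A and B, so that what is
    proved for A also holds for B. *)
Lemma join_onC U A B S (a : rvec A S) (b : rvec B S) (sg : pvec S) :
  S \subset A -> S \subset B -> complete e S ->
  join_on U (join a sg) b = join_on U (join b sg) a.
Proof.
move=> SA SB cS; apply: eq_pack => x _.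
rewrite (ext_join SA cS) (ext_join SB cS) /=.
move: (ext sg x) (ext a x) (ext b x) (shift a x) (shift b x) => p q r t u.
by rewrite -!addrA; congr (_ + _)%R; rewrite addrA [RHS]addrA addrC.
Qed.

Lemma measurable_margpar U W : measurable_fun setT (@margpar R V L z e U W).
Proof.
apply: measurable_pack => x _; apply: measurable_moebius => y.
exact: measurable_ext.
Qed.

Lemma mule_shuffle (p q u v w : \bar R) :
  p * q * (v * (u * w)) = w * (q * v) * (p * u).
Proof.
rewrite [RHS]muleC -[RHS]muleA -[LHS]muleA; congr (_ * _).
by rewrite [LHS]muleA [RHS]muleA muleC.
Qed.

(** In the coordinates (a, b, sigma) the kernel is a product, and the marginal
    parameters on A and B depend on (a, sigma) and (b, sigma) only. *)
Lemma integral_decomposition U A B S (phi : pvec A -> \bar R) (psi : pvec B -> \bar R) :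
  (A :|: B = U)%SET -> (A :&: B = S)%SET -> complete e S ->
  (forall D, D \in cliques e U -> D \subset A \/ D \subset B) ->
  measurable_fun setT phi -> (forall t, 0 <= phi t) ->
  measurable_fun setT psi -> (forall t, 0 <= psi t) ->
  \int[lebesgue_vec R (subfin (par U))]_t
    (phi (margpar A t) * psi (margpar B t) * (kern U (ext t))%:E) =
  \int[lebesgue_vec R (subfin (par S))]_sg
    ((kern S (ext sg))%:E * (fiberint phi sg * fiberint psi sg)).
Proof.
move=> hU hS cS cl mphi phi0 mpsi psi0.
have SA : S \subset A by rewrite -hS finset.subsetIl.
have SB : S \subset B by rewrite -hS finset.subsetIr.
rewrite (integral_join_on hU hS cS cl); last 2 first.
- apply: emeasurable_funM; last exact: measurable_ekernel.
  by apply: emeasurable_funM; [apply: (measurableT_comp mphi)|apply: (measurableT_comp mpsi)];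
    exact: measurable_margpar.
- by move=> t; rewrite !mule_ge0// kernel_ge0.
apply: eq_integral => sg _.
have mfib (C : {set V}) (xi : pvec C -> \bar R) : measurable_fun setT xi ->
    measurable_fun setT (fun a : rvec C S => xi (join a sg) * (weight a)%:E).
  move=> mxi.
  exact: measurableT_comp (measurable_fiber mxi) (measurable_pair1 sg).
have fib0 (C : {set V}) (xi : pvec C -> \bar R) : (forall t, 0 <= xi t) ->
    forall a : rvec C S, 0 <= xi (join a sg) * (weight a)%:E.
  by move=> xi0 a; rewrite mule_ge0// lee_fin expR_ge0.
transitivity (\int[lebesgue_vec R (subfin (resid B S))]_b
    ((kern S (ext sg))%:E * fiberint phi sg * (psi (join b sg) * (weight b)%:E))).
  apply: eq_integral => b _.
  transitivity (\int[lebesgue_vec R (subfin (resid A S))]_a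
    ((kern S (ext sg))%:E * (psi (join b sg) * (weight b)%:E) *
     (phi (join a sg) * (weight a)%:E))).
    apply: eq_integral => a _.
    have aE : margpar A (join_on U (join a sg) b) = join a sg.
      exact: (margpar_join_on hU hS cS cl).
    have bE : margpar B (join_on U (join a sg) b) = join b sg.
      have hU' : (B :|: A = U)%SET by rewrite finset.setUC.
      have hS' : (B :&: A = S)%SET by rewrite finset.setIC.
      have cl' D : D \in cliques e U -> D \subset B \/ D \subset A.
        by move=> /cl[|]; [right|left].
      rewrite (join_onC U a b sg SA SB cS).
      exact: (margpar_join_on hU' hS' cS cl').
    have kE : kern U (ext (join_on U (join a sg) b)) =
        (weight b * (weight a * kern S (ext sg)))%R.
      by rewrite (kernel_join_on hU hS cS cl) (kernel_join s alpha SA cS).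
    rewrite aE bE kE !EFinM.
    exact: mule_shuffle.
  rewrite ge0_integralZl//; last 3 first.
  - exact: mfib.
  - by move=> a _; exact: fib0.
  - by rewrite mule_ge0 ?kernel_ge0// fib0.
  by rewrite -muleA -[RHS]muleA; congr (_ * _); rewrite muleC.
rewrite ge0_integralZl//; last 3 first.
- exact: mfib.
- by move=> a _; exact: fib0.
- by rewrite mule_ge0 ?kernel_ge0// fiberint_ge0.
by rewrite -muleA.
Qed.

End fiber_integral.

(** * Normalising constants and prior densities *)

Section positive_integral.
Variables (R : realType) (J : finType).
Local Open Scope ereal_scope.

Lemma lebesgue_vec_gt0 : 0 < lebesgue_vec R J setT.
Proof.
pose A (j : J) : set R := `[0%R, 1%R]%classic.
have mA j : measurable (A j) by exact: measurable_itv.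
apply: (@lt_le_trans _ _ (lebesgue_vec R J [set t | forall j, A j (coord t j)])).
  rewrite lebesgue_vec_box// big1 ?lte01// => j _.
  by rewrite lebesgue_measure_itv/= lte_fin ltr01 oppr0 adde0.
by apply: le_measure => //; rewrite inE//; exact: measurable_box.
Qed.

(** An integral equal to zero would make the positive function vanish almost
    everywhere, but Lebesgue measure is not zero. *)
Lemma integral_vec_gt0 (F : vec R J -> R) :
  measurable_fun setT F -> (forall t, (0 < F t)%R) ->
  0 < \int[lebesgue_vec R J]_t (F t)%:E.
Proof.
move=> mF F0; rewrite lt0e; apply/andP; split; last first.
  by apply: integral_ge0 => t _; rewrite lee_fin ltW.
apply/eqP => I0.
have mEF : measurable_fun setT (EFin \o F) by exact/measurable_EFinP.
have abs0 : \int[lebesgue_vec R J]_(t in setT) `|(EFin \o F) t| = 0.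
  rewrite -[RHS]I0; apply: eq_integral => t _.
  by rewrite gee0_abs// lee_fin ltW.
have [N [mN N0 sN]] := (ae_eq_integral_abs (lebesgue_vec R J) measurableT mEF).1 abs0.
have NT : N = setT.
  apply/seteqP; split=> // t _; apply: sN => /= /(_ I) [] Ft0.
  by have := F0 t; rewrite Ft0 ltxx.
by have := lebesgue_vec_gt0; rewrite -NT N0 ltxx.
Qed.

End positive_integral.

Section prior.
Variables (R : realType) (V : finType) (L : V -> finType) (z : forall v, L v).
Variable e : rel V.
Variables (s : {set V} * cell L -> R) (alpha : R).
Implicit Types (A B S U : {set V}).

Local Notation par := (par z e).
Local Notation pvec U := (vec R (subfin (par U))).
Local Notation resid := (resid z e).
Local Notation weight := (weight s alpha).
Local Notation kern := (model_kernel z s alpha).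
Local Notation fiberint := (fiberint s alpha).

Local Open Scope ereal_scope.

Definition normconst U : \bar R :=
  \int[lebesgue_vec R (subfin (par U))]_t (kern U (ext t))%:E.

Definition fiberconst A S : \bar R :=
  \int[lebesgue_vec R (subfin (resid A S))]_a (weight a)%:E.

Definition conj_prior U (t : pvec U) : R := ((fine (normconst U))^-1 * kern U (ext t))%R.

(** Under the prior on A, the fibre coordinates have density proportional to
    [weight], independently of the S-marginal; this is the conditional
    expectation of [phi] given that the S-marginal has parameters [sg]. *)
Definition fiber_mean A S (phi : pvec A -> \bar R) (sg : pvec S) : \bar R :=
  ((fine (fiberconst A S))^-1)%:E * fiberint phi sg.

Lemma normconst_gt0 U : 0 < normconst U.
Proof. by apply: integral_vec_gt0 => [|t]; [exact: measurable_kernel|exact: expR_gt0]. Qed.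

Lemma fiberconst_gt0 A S : 0 < fiberconst A S.
Proof. by apply: integral_vec_gt0 => [|t]; [exact: measurable_weight|exact: expR_gt0]. Qed.

Lemma measurable_prior U : measurable_fun setT (@conj_prior U).
Proof. by apply: measurable_funM => //; exact: measurable_kernel. Qed.

Lemma prior_ge0 U t : (0 <= @conj_prior U t)%R.
Proof.
by rewrite mulr_ge0 ?expR_ge0// invr_ge0 fine_ge0// ltW// normconst_gt0.
Qed.

Lemma fiberint1 A S (sg : pvec S) : fiberint (fun _ : pvec A => 1) sg = fiberconst A S.
Proof. by apply: eq_integral => a _; rewrite mul1e. Qed.

Lemma fine_gt0_num (x : \bar R) : 0 < x -> x < +oo ->
  exists2 r : R, (0 < r)%R & x = r%:E.
Proof. by case: x => // r r0 _; exists r. Qed.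

Lemma integral_prior U (F : pvec U -> \bar R) :
  measurable_fun setT F -> (forall t, 0 <= F t) ->
  \int[lebesgue_vec R (subfin (par U))]_t (F t * (conj_prior t)%:E) =
  ((fine (normconst U))^-1)%:E *
  \int[lebesgue_vec R (subfin (par U))]_t (F t * (kern U (ext t))%:E).
Proof.
move=> mF F0; rewrite -ge0_integralZl//.
- by apply: eq_integral => t _; rewrite EFinM muleCA.
- by apply: emeasurable_funM => //; exact: measurable_ekernel.
- by move=> t _; rewrite mule_ge0 ?kernel_ge0.
- by rewrite lee_fin invr_ge0 fine_ge0// ltW// normconst_gt0.
Qed.

Lemma fiber_mean_ge0 A S (phi : pvec A -> \bar R) (sg : pvec S) :
  (forall t, 0 <= phi t) -> 0 <= fiber_mean phi sg.
Proof.
move=> phi0; rewrite mule_ge0 ?fiberint_ge0//.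
by rewrite lee_fin invr_ge0 fine_ge0// ltW// fiberconst_gt0.
Qed.

Lemma measurable_fiber_mean A S (phi : pvec A -> \bar R) :
  measurable_fun setT phi -> (forall t, 0 <= phi t) ->
  measurable_fun setT (fun sg : pvec S => fiber_mean phi sg).
Proof.
move=> mphi phi0; apply: emeasurable_funM => //.
exact: measurable_fiberint.
Qed.

(** A function of the S-marginal is constant along the fibres. *)
Lemma fiber_mean_scale A S (phi : pvec A -> \bar R) (chi : pvec S -> \bar R) (sg : pvec S) :
  S \subset A -> complete e S ->
  measurable_fun setT phi -> (forall t, 0 <= phi t) -> (forall t, 0 <= chi t) ->
  fiber_mean (fun t => phi t * chi (margpar S t)) sg = chi sg * fiber_mean phi sg.
Proof.
move=> SA cS mphi phi0 chi0; rewrite /fiber_mean muleCA; congr (_ * _).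
rewrite -ge0_integralZl//.
- by apply: eq_integral => a _; rewrite (margpar_join SA cS) [_ * chi sg]muleC -muleA.
- exact: measurableT_comp (measurable_fiber s alpha mphi) (measurable_pair1 sg).
- by move=> a _; rewrite mule_ge0// lee_fin expR_ge0.
Qed.

Section fiber.
Variables A S : {set V}.
Hypotheses (SA : S \subset A) (cS : complete e S) (IA : normconst A < +oo).

Lemma normconst_fiber : normconst A = fiberconst A S * normconst S.
Proof.
have := @integral_kernel_fiber _ _ _ z e s alpha A S (fun=> 1) SA cS
  (measurable_cst _) (fun=> lee01).
under eq_integral do rewrite mul1e.
rewrite -/(normconst A) => ->.
under eq_integral do rewrite fiberint1 muleC.
rewrite ge0_integralZl//.
- exact: measurable_ekernel.
- by move=> t _; exact: kernel_ge0.
- by rewrite ltW// fiberconst_gt0.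
Qed.

(** Both factors of [normconst_fiber] are positive. *)
Lemma normconst_sep_fin : fiberconst A S < +oo /\ normconst S < +oo.
Proof.
split; rewrite ltey; apply/eqP => E; move: IA; rewrite normconst_fiber E.
  by rewrite gt0_mulye ?normconst_gt0// ltxx.
by rewrite gt0_muley ?fiberconst_gt0// ltxx.
Qed.

Lemma fiber_mean1 (sg : pvec S) : fiber_mean (fun _ : pvec A => 1) sg = 1.
Proof.
rewrite /fiber_mean fiberint1.
have [r r0 ->] := fine_gt0_num (fiberconst_gt0 A S) normconst_sep_fin.1.
by rewrite -EFinM mulVf// gt_eqF.
Qed.

Lemma integral_prior_fiber (phi : pvec A -> \bar R) :
  measurable_fun setT phi -> (forall t, 0 <= phi t) ->
  \int[lebesgue_vec R (subfin (par A))]_t (phi t * (conj_prior t)%:E) =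
  \int[lebesgue_vec R (subfin (par S))]_sg (fiber_mean phi sg * (conj_prior sg)%:E).
Proof.
move=> mphi phi0; rewrite integral_prior// integral_prior; last 2 first.
- exact: measurable_fiber_mean.
- by move=> t; exact: fiber_mean_ge0.
rewrite (@integral_kernel_fiber _ _ _ z e s alpha A S phi SA cS mphi phi0).
have [/(fine_gt0_num (fiberconst_gt0 A S))[r r0 rE]
  /(fine_gt0_num (normconst_gt0 S))[q q0 qE]] := normconst_sep_fin.
rewrite normconst_fiber rE qE /fiber_mean rE /=.
under [in RHS]eq_integral do rewrite -muleA.
rewrite ge0_integralZl//; last 3 first.
- by apply: emeasurable_funM; [exact: measurable_fiberint|exact: measurable_ekernel].
- by move=> t _; rewrite mule_ge0 ?kernel_ge0// fiberint_ge0.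
- by rewrite lee_fin invr_ge0 ltW.
rewrite muleA -EFinM -invfM mulrC; congr (_ * _).
by apply: eq_integral => t _; rewrite muleC.
Qed.

End fiber.
End prior.

(** * Factorisation of the prior over a decomposition *)

Section consistency.
Variables (R : realType) (V : finType) (L : V -> finType) (z : forall v, L v).
Variable e : rel V.
Variables (s : {set V} * cell L -> R) (alpha : R).
Implicit Types (A B S U : {set V}).

Local Notation par := (par z e).
Local Notation pvec U := (vec R (subfin (par U))).
Local Notation resid := (resid z e).
Local Notation rvec A S := (vec R (subfin (resid A S))).
Local Notation weight := (weight s alpha).
Local Notation kern := (model_kernel z s alpha).
Local Notation fiberint := (fiberint s alpha).
Local Notation fmean := (fiber_mean s alpha).
Local Notation prior := (conj_prior s alpha).
Local Notation normconst := (normconst z e s alpha).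
Local Notation fiberconst := (fiberconst z e s alpha).

Local Open Scope ereal_scope.

(** The S-block of the preimage is the one of [t] translated back. *)
Lemma join_surj A S (t : pvec A) : S \subset A -> complete e S ->
  exists (a : rvec A S) (sg : pvec S), t = join a sg.
Proof.
move=> SA cS; pose a : rvec A S := pack (resid A S) (ext t).
exists a, (pack (par S) (ext t \+ shift a)%R).
rewrite -[LHS]extK; apply: eq_pack => x xA /=; rewrite !ext_pack /resid xA /=.
case: ifPn => /= xS; first by rewrite addrK addr0.
by rewrite (shift_par cS)// subrr add0r.
Qed.

Section decomposition.
Variables U A B S : {set V}.
Hypotheses (hU : (A :|: B = U)%SET) (hS : (A :&: B = S)%SET).
Hypothesis cS : complete e S.
Hypothesis cl : forall D, D \in cliques e U -> D \subset A \/ D \subset B.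

Let SA : S \subset A. Proof. by rewrite -hS finset.subsetIl. Qed.
Let SB : S \subset B. Proof. by rewrite -hS finset.subsetIr. Qed.

Lemma join_on_surj (t : pvec U) :
  exists (t' : pvec A) (b : rvec B S), t = join_on U t' b.
Proof.
pose b : rvec B S := pack (resid B S) (ext t).
exists (pack (par A) (ext t \+ shift b)%R), b.
rewrite -[LHS]extK; apply: eq_pack => x xU /=; rewrite !ext_pack.
have := splits_decomposition z hU hS cl x; rewrite xU.
case: (boolP (par A x)) => xA; first by rewrite andbT => -[_ /negbTE ->]; rewrite addrK addr0.
rewrite orbF => -[<- _]; rewrite (shift_par cS) ?subrr ?add0r//.
by apply: contra xA; exact: par_sub.
Qed.

Lemma margsum_margpar (t : pvec U) : exists k, forall i, i \in cells z A ->
  margsum z U A (expR \o linpot z (ext t)) i = expR (k + linpot z (ext (margpar A t)) i).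
Proof.
have [t' [b ->]] := join_on_surj t.
rewrite (margpar_join_on hU hS cS cl); exists (logsum0 z B S (ext b)) => i iA.
exact: (margsum_join_on hU hS cS cl).
Qed.

Hypothesis IU : normconst U < +oo.

Lemma normconst_decomposition :
  normconst U = fiberconst A S * fiberconst B S * normconst S.
Proof.
have := @integral_decomposition _ _ _ z e s alpha U A B S (fun=> 1) (fun=> 1)
  hU hS cS cl (measurable_cst _) (fun=> lee01) (measurable_cst _) (fun=> lee01).
under eq_integral do rewrite !mul1e.
rewrite -/(normconst U) => ->.
under eq_integral do rewrite !fiberint1 muleC.
rewrite ge0_integralZl//.
- exact: measurable_ekernel.
- by move=> t _; exact: kernel_ge0.
- by rewrite mule_ge0// ltW// fiberconst_gt0.
Qed.

Lemma fiberconst_fin : [/\ fiberconst A S < +oo, fiberconst B S < +oo & normconst S < +oo].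
Proof.
have gA := fiberconst_gt0 z e s alpha A S.
have gB := fiberconst_gt0 z e s alpha B S.
have gS := normconst_gt0 z e s alpha S.
split; rewrite ltey; apply/eqP => E; move: IU; rewrite normconst_decomposition E.
- by rewrite !gt0_mulye// ltxx.
- by rewrite gt0_muley// gt0_mulye// ltxx.
- by rewrite gt0_muley ?mule_gt0// ltxx.
Qed.

Lemma normconst_left_fin : normconst A < +oo.
Proof.
have [] := fiberconst_fin; rewrite (@normconst_fiber _ _ _ z e s alpha A S SA cS).
move=> /(fine_gt0_num (fiberconst_gt0 z e s alpha A S))[r r0 ->] _.
by move=> /(fine_gt0_num (normconst_gt0 z e s alpha S))[q q0 ->]; rewrite -EFinM ltey.
Qed.

Lemma integral_prior_decomposition (phi : pvec A -> \bar R) (psi : pvec B -> \bar R) :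
  measurable_fun setT phi -> (forall t, 0 <= phi t) ->
  measurable_fun setT psi -> (forall t, 0 <= psi t) ->
  \int[lebesgue_vec R (subfin (par U))]_t
    (phi (margpar A t) * psi (margpar B t) * (prior t)%:E) =
  \int[lebesgue_vec R (subfin (par S))]_sg
    (fmean phi sg * fmean psi sg * (prior sg)%:E).
Proof.
move=> mphi phi0 mpsi psi0.
have mAB : measurable_fun setT (fun t : pvec U => phi (margpar A t) * psi (margpar B t)).
  by apply: emeasurable_funM; [apply: (measurableT_comp mphi)|apply: (measurableT_comp mpsi)];
    exact: measurable_margpar.
rewrite (integral_prior s alpha mAB); last by move=> t; rewrite mule_ge0.
have mE : measurable_fun setT (fun sg : pvec S => fmean phi sg * fmean psi sg).
  by apply: emeasurable_funM; exact: measurable_fiber_mean.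
rewrite (integral_prior s alpha mE); last by move=> t; rewrite mule_ge0// fiber_mean_ge0.
rewrite (@integral_decomposition _ _ _ z e s alpha U A B S phi psi hU hS cS cl mphi phi0 mpsi psi0).
have [] := fiberconst_fin.
move=> /(fine_gt0_num (fiberconst_gt0 z e s alpha A S))[a a0 aE].
move=> /(fine_gt0_num (fiberconst_gt0 z e s alpha B S))[b b0 bE].
move=> /(fine_gt0_num (normconst_gt0 z e s alpha S))[q q0 qE].
rewrite normconst_decomposition /fiber_mean aE bE qE /=.
transitivity ((q^-1)%:E * \int[lebesgue_vec R (subfin (par S))]_sg
  ((a^-1 * b^-1)%:E * ((kern S (ext sg))%:E * (fiberint phi sg * fiberint psi sg)))).
  rewrite ge0_integralZl//; last 3 first.
  - apply: emeasurable_funM; first exact: measurable_ekernel.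
    by apply: emeasurable_funM; exact: measurable_fiberint.
  - by move=> t _; rewrite !mule_ge0 ?kernel_ge0// fiberint_ge0.
  - by rewrite lee_fin mulr_ge0// invr_ge0 ltW.
  rewrite muleA -EFinM; congr (_%:E * _); rewrite !invfM.
  by rewrite mulrC.
congr (_ * _); apply: eq_integral => t _.
rewrite muleCA [RHS]muleC; congr (_ * _).
by rewrite EFinM muleACA.
Qed.

(** The fibre mean over B of the constant 1 is 1. *)
Lemma integral_prior_left (phi : pvec A -> \bar R) :
  measurable_fun setT phi -> (forall t, 0 <= phi t) ->
  \int[lebesgue_vec R (subfin (par U))]_t (phi (margpar A t) * (prior t)%:E) =
  \int[lebesgue_vec R (subfin (par A))]_t (phi t * (prior t)%:E).
Proof.
move=> mphi phi0.
rewrite (integral_prior_fiber SA cS normconst_left_fin mphi phi0).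
transitivity (\int[lebesgue_vec R (subfin (par U))]_t
    (phi (margpar A t) * cst 1 (margpar B t) * (prior t)%:E)).
  by apply: eq_integral => t _; rewrite mule1.
rewrite (@integral_prior_decomposition phi (cst 1))//.
have [_ cBoo _] := fiberconst_fin.
apply: eq_integral => t _; congr (_ * _).
have [b b0 bE] := fine_gt0_num (fiberconst_gt0 z e s alpha B S) cBoo.
have -> : fmean (cst 1 : pvec B -> \bar R) t = 1.
  rewrite /fiber_mean; rewrite [X in _ * X](_ : _ = fiberconst B S).
    by rewrite bE -EFinM mulVf// gt_eqF.
  exact: fiberint1.
by rewrite mule1.
Qed.

End decomposition.

(** Both sides equal w_A(a) w_B(b) K_S(sigma)^2 / (C_A C_B I_S^2). *)
Lemma prior_factor U A B S (t : pvec U) :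
  (A :|: B = U)%SET -> (A :&: B = S)%SET -> complete e S ->
  (forall D, D \in cliques e U -> D \subset A \/ D \subset B) ->
  normconst U < +oo ->
  (prior t * prior (margpar S (margpar A t)) = prior (margpar A t) * prior (margpar B t))%R.
Proof.
move=> hU hS cS cl IU.
have SA : S \subset A by rewrite -hS finset.subsetIl.
have SB : S \subset B by rewrite -hS finset.subsetIr.
have hU' : (B :|: A = U)%SET by rewrite finset.setUC.
have hS' : (B :&: A = S)%SET by rewrite finset.setIC.
have cl' D : D \in cliques e U -> D \subset B \/ D \subset A.
  by move=> /cl[|]; [right|left].
have [t' [b ->]] := join_on_surj hU hS cS cl t.
have [a [sg ->]] := join_surj t' SA cS.
rewrite (margpar_join_on hU hS cS cl) (margpar_join SA cS).
rewrite {2}(join_onC U a b sg SA SB cS) (margpar_join_on hU' hS' cS cl').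
rewrite /conj_prior (kernel_join_on s alpha hU hS cS cl) (kernel_join s alpha SA cS).
rewrite (kernel_join s alpha SB cS).
have [] := fiberconst_fin hU hS cS cl IU.
move=> /(fine_gt0_num (fiberconst_gt0 z e s alpha A S))[ca ca0 aE].
move=> /(fine_gt0_num (fiberconst_gt0 z e s alpha B S))[cb cb0 bE].
move=> /(fine_gt0_num (normconst_gt0 z e s alpha S))[q q0 qE].
rewrite (normconst_decomposition hU hS cS cl).
rewrite (@normconst_fiber _ _ _ z e s alpha A S SA cS).
rewrite (@normconst_fiber _ _ _ z e s alpha B S SB cS) aE bE qE /=.
move: (weight a) (weight b) (kern S _) => u v w.
rewrite !invfM.
move: ca^-1%R cb^-1%R q^-1%R => x y r; ring.
Qed.

End consistency.

(** * Marginal tables of the full model *)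

Section marginals.
Variables (R : realType) (V : finType) (L : V -> finType) (z : forall v, L v).
Variable e : rel V.
Implicit Types (A B S U W : {set V}).

Local Notation par := (par z e).
Local Notation pvec U := (vec R (subfin (par U))).
Local Notation cells := (cells z).
Local Notation margsum := (margsum z).
Local Notation linpot := (linpot z).
Local Notation fullT := [set: V]%SET.

Implicit Types th : vec R (params z e fullT).

Lemma margE th W i : marg th W i = margsum fullT W (prob th) i.
Proof. by apply: eq_bigl => j; rewrite cellsT. Qed.

Lemma marg_paramE th W : marg_param th W = pack (par W) (fun x =>
  moebius (fun F => ln (marg th W (restr z F x.2))) x.1).
Proof. by congr mkvec; apply/funext => x; case: (val x). Qed.

(** The normalisation is left free, as the total mass 1 determines it. *)
Definition represents th W (t : pvec W) := exists k, forall i, i \in cells W ->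
  marg th W i = expR (k + linpot (ext t) i).

Lemma moebius_ln_linpot k W (t : pvec W) (q : cell L -> R) x :
  (forall i, i \in cells W -> q i = expR (k + linpot (ext t) i)) ->
  par W x -> moebius (fun F => ln (q (restr z F x.2))) x.1 = ext t x.
Proof.
case: x => D i qE /parP[D0 _ DW iD] /=.
rewrite -(moebius_linpot k (ext t) iD D0); apply: eq_bigr => F FD; congr (_ * _).
rewrite qE ?expRK//; apply: cellsS (restr_cells _ _ _).
exact: fintype.subset_trans FD DW.
Qed.

Lemma represents_param th W (t : pvec W) : represents th t -> marg_param th W = t.
Proof.
move=> [k tE]; rewrite marg_paramE -[RHS]extK; apply: eq_pack => x xW.
exact: moebius_ln_linpot tE xW.
Qed.

(** Proportional tables of total mass 1 are equal. *)
Lemma represents_prob th W (t : pvec W) i : represents th t -> i \in cells W ->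
  marg th W i = prob (t : vec R (params z e W)) i.
Proof.
move=> [k tE] iW.
have kZ : expR k * partition_sum z W (ext t) = 1.
  rewrite /partition_sum mulr_sumr.
  rewrite -[RHS](_ : \sum_(j in cells fullT) prob th j = 1); last first.
    rewrite (eq_bigr (fun j => expR (linpot (ext (th : pvec fullT)) j) /
      partition_sum z fullT (ext (th : pvec fullT)))) => [|j _]; last exact: probE.
    by rewrite -mulr_suml divff// gt_eqF// partition_sum_gt0.
  rewrite -(margsum_total z fullT W); apply: eq_bigr => j jW.
  by rewrite -expRD -tE// margE.
rewrite tE// expRD probE mulrC; congr (_ * _).
by apply: (mulIf (lt0r_neq0 (partition_sum_gt0 z W (ext t)))); rewrite kZ mulVf// gt_eqF// partition_sum_gt0.
Qed.

Lemma represents_table th W (t : pvec W) : represents th t ->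
  marg_table th W = table (t : vec R (params z e W)).
Proof.
move=> tE; congr mkvec; apply/funext => i; apply: represents_prob => //.
exact: (valP i).
Qed.

Lemma represents_setT th : represents th (th : pvec fullT).
Proof.
exists (- ln (partition_sum z fullT (ext (th : pvec fullT)))) => i _.
rewrite margE /margsum (big_pred1 i) => [|j].
  by rewrite probE addrC expRD expRN lnK// posrE partition_sum_gt0.
by rewrite cellsT restr_id ?cellsT.
Qed.

Lemma represents_trans th U W (t : pvec U) (t' : pvec W) : W \subset U ->
  represents th t ->
  (exists k, forall i, i \in cells W ->
    margsum U W (expR \o linpot (ext t)) i = expR (k + linpot (ext t') i)) ->
  represents th t'.
Proof.
move=> WU [k tE] [k' tE']; exists (k + k') => i iW.
rewrite margE (margsum_trans _ _ WU iW).
transitivity (margsum U W (fun j => expR k * (expR \o linpot (ext t)) j) i).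
  by apply: eq_bigr => j /andP[jU _]; rewrite -margE tE// expRD.
by rewrite margsum_scale tE'// -expRD addrA.
Qed.

(** This holds for every W, even when the W-marginal is not log-linear with
    interactions in the cliques of W; it gives the measurability of marginal
    parameters. *)
Lemma marg_param_margpar th W : marg_param th W = margpar W (th : pvec fullT).
Proof.
rewrite marg_paramE; apply: eq_pack => -[D i] /parP[D0 _ DW _] /=.
pose c := ext (th : pvec fullT); pose k := ln (partition_sum z fullT c).
have cE j : j \in cells W -> ln (margsum fullT W (expR \o linpot c) j) = k + ln (marg th W j).
  move=> jW; rewrite margE.
  have -> : margsum fullT W (prob th) j =
      (partition_sum z fullT c)^-1 * margsum fullT W (expR \o linpot c) j.
    rewrite -margsum_scale; apply: eq_margsum => j'.
    by rewrite probE mulrC.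
  rewrite lnM ?posrE ?invr_gt0 ?partition_sum_gt0//; last first.
    by apply: margsum_gt0 => // j'; exact: expR_gt0.
  by rewrite lnV ?posrE ?partition_sum_gt0// addrA subrr add0r.
have /set0Pn[v vD] := D0.
have k0 : moebius (fun=> k) D = 0 by apply: (moebius_eq0 vD).
rewrite -[LHS]add0r -k0 /moebius -big_split/=; apply: eq_bigr => F FD.
rewrite -mulrDr cE//; apply: cellsS (restr_cells _ _ _).
exact: fintype.subset_trans FD DW.
Qed.

End marginals.

(** * Expectations under a density *)

Section expectation.
Variables (R : realType) (d : measure_display) (T : measurableType d).
Variable Pr : probability T R.
Local Open Scope ereal_scope.

(** F(x) is the length of the interval from 0 to F(x), so that Tonelli reduces
    the claim to the probabilities of the sets where F exceeds a level r. *)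
Lemma expectation_density (J : finType) (X : T -> vec R J) (f F : vec R J -> R) :
  measurable_fun setT X -> has_density Pr X f ->
  measurable_fun setT f -> (forall x, (0 <= f x)%R) ->
  measurable_fun setT F -> (forall x, (0 <= F x)%R) ->
  \int[Pr]_w (F (X w))%:E = \int[lebesgue_vec R J]_x ((F x)%:E * (f x)%:E).
Proof.
move=> mX Xf mf f0 mF F0.
(* The region under the graph of F. *)
pose D : set (vec R J * R) := [set y | (0 <= y.2 < F y.1)%R].
have mD : measurable D.
  have m1 : measurable_fun setT (fun y : vec R J * R => F y.1).
    exact: measurableT_comp mF measurable_fst.
  have mb : measurable_fun setT
      (fun y : vec R J * R => ((0 <= y.2)%R && (y.2 < F y.1)%R)).
    apply: measurable_and.
      by apply: measurable_fun_ler => //; exact: measurable_snd.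
    by apply: measurable_fun_ltr => //; exact: measurable_snd.
  have mbT : measurable (setT `&` (fun y : vec R J * R =>
      ((0 <= y.2)%R && (y.2 < F y.1)%R)) @^-1` [set true]) by exact: mb.
  by move: mbT; rewrite setTI.
have layer (r : R) : (0 <= r)%R ->
    r%:E = \int[lebesgue_measure]_t (\1_(`[0%R, r[%classic : set R) t)%:E.
  move=> r0; transitivity (lebesgue_measure (`[0%R, r[%classic : set R)).
    rewrite lebesgue_measure_itv/= lte_fin.
    by case: ltgtP r0 => // [r0|<-] _; rewrite ?oppr0 ?adde0.
  by rewrite integral_indic// setIT.
have indE y r : \1_(`[0%R, F y[%classic : set R) r = \1_D (y, r) :> R.
  by rewrite !indicE; congr (nat_of_bool _)%:R; apply/idP/idP;
    rewrite !inE /D /= in_itv.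
have mI : measurable_fun setT (fun y : vec R J * R => (\1_D y : R)%:E).
  by apply/measurable_EFinP; exact: measurable_indic.
transitivity (\int[Pr]_w \int[lebesgue_measure]_r (\1_D (X w, r))%:E).
  apply: eq_integral => w _; rewrite (layer _ (F0 (X w))).
  by apply: eq_integral => r _; rewrite indE.
have mXI : measurable_fun setT (fun y : T * R => (\1_D (X y.1, y.2) : R)%:E).
  have mp : measurable_fun setT (fun y : T * R => (X y.1, y.2)).
    apply/measurable_fun_pairP; split; last exact: measurable_snd.
    exact: measurableT_comp mX measurable_fst.
  exact: measurableT_comp mI mp.
transitivity (\int[lebesgue_measure]_r \int[Pr]_w (\1_D (X w, r))%:E).
  have I0 (y : T * R) : 0 <= (\1_D (X y.1, y.2) : R)%:E by rewrite lee_fin.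
  exact: (fubini_tonelli (m1 := Pr) (m2 := @lebesgue_measure R) _ mXI I0).
have mDr r : measurable [set x : vec R J | D (x, r)].
  have mpair : measurable_fun setT (fun x : vec R J => (x, r)) by [].
  by rewrite -[X in measurable X]setTI; exact: mpair.
have mDf : measurable_fun setT
    (fun y : vec R J * R => (\1_D y : R)%:E * (f y.1)%:E).
  apply: emeasurable_funM => //; apply/measurable_EFinP.
  exact: measurableT_comp mf measurable_fst.
transitivity (\int[lebesgue_measure]_r \int[lebesgue_vec R J]_x
    ((\1_D (x, r))%:E * (f x)%:E)).
  apply: eq_integral => r _.
  transitivity (Pr (X @^-1` [set x | D (x, r)])).
    rewrite -[in RHS](setIT (X @^-1` _)) -integral_indic//.
    by rewrite -[X in measurable X]setTI; exact: mX.
  rewrite Xf// integral_mkcond epatch_indic; apply: eq_integral => x _.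
  by rewrite muleC.
transitivity (\int[lebesgue_vec R J]_x \int[lebesgue_measure]_r
    ((\1_D (x, r))%:E * (f x)%:E)).
  apply/esym.
  have Df0 (y : vec R J * R) : 0 <= (\1_D y : R)%:E * (f y.1)%:E.
    by rewrite mule_ge0// lee_fin.
  exact: (fubini_tonelli (m1 := lebesgue_vec R J) (m2 := @lebesgue_measure R)
    _ mDf Df0).
apply: eq_integral => x _; rewrite ge0_integralZr//; last 2 first.
- exact: measurableT_comp mI (measurable_pair1 x).
- by rewrite lee_fin.
by rewrite [in RHS](layer _ (F0 x)); congr (_ * _).
Qed.

End expectation.

(** * Priors inherited by marginal models *)

Section consistent_marginals.
Variables (R : realType) (V : finType) (L : V -> finType) (z : forall v, L v).
Variable e : rel V.
Variables (s : {set V} * cell L -> R) (alpha : R).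
Implicit Types (A B S U W : {set V}).

Local Notation par := (par z e).
Local Notation pvec U := (vec R (subfin (par U))).
Local Notation fmean := (fiber_mean s alpha).
Local Notation prior := (conj_prior s alpha).
Local Notation normconst := (normconst z e s alpha).
Local Notation fullT := [set: V]%SET.

Local Open Scope ereal_scope.

(** These properties pass together from a set to both sides of a decomposition
    and to complete separators. *)
Definition consistent W := [/\ normconst W < +oo,
  forall th : pvec fullT, represents (th : vec R (params z e fullT)) (margpar W th)
  & forall phi : pvec W -> \bar R, measurable_fun setT phi -> (forall t, 0 <= phi t) ->
    \int[lebesgue_vec R (subfin (par fullT))]_th (phi (margpar W th) * (prior th)%:E) =
    \int[lebesgue_vec R (subfin (par W))]_t (phi t * (prior t)%:E)].

Lemma margpar_setT (th : pvec fullT) : margpar fullT th = th.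
Proof.
rewrite -(marg_param_margpar (th : vec R (params z e fullT))).
exact/represents_param/represents_setT.
Qed.

Lemma consistent_setT : normconst fullT < +oo -> consistent fullT.
Proof.
move=> IT; split=> // [th|phi mphi phi0].
  by rewrite margpar_setT; exact: represents_setT.
by apply: eq_integral => th _; rewrite margpar_setT.
Qed.

Lemma margpar_trans U W (th : pvec fullT) : W \subset U ->
  represents (th : vec R (params z e fullT)) (margpar U th) ->
  (forall t : pvec U, exists k, forall i, i \in cells z W ->
    margsum z U W (expR \o linpot z (ext t)) i = expR (k + linpot z (ext (margpar W t)) i)%R) ->
  represents (th : vec R (params z e fullT)) (margpar W (margpar U th)) /\
  margpar W th = margpar W (margpar U th).
Proof.
move=> WU rU mU; have rW := represents_trans WU rU (mU _); split; first exact: rW.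
exact: etrans (esym (marg_param_margpar th W)) (represents_param rW).
Qed.

Section decomposition.
Variables U A B S : {set V}.
Hypotheses (hU : (A :|: B = U)%SET) (hS : (A :&: B = S)%SET).
Hypothesis cS : complete e S.
Hypothesis cl : forall D, D \in cliques e U -> D \subset A \/ D \subset B.
Hypothesis U_consistent : consistent U.

Lemma margpar_left (th : pvec fullT) :
  represents (th : vec R (params z e fullT)) (margpar A (margpar U th)) /\
  margpar A th = margpar A (margpar U th).
Proof.
have [_ rU _] := U_consistent.
apply: margpar_trans (rU th) _; first by rewrite -hU finset.subsetUl.
by move=> t; exact: (margsum_margpar hU hS cS cl).
Qed.

Lemma consistent_left : consistent A.
Proof.
have [IU rU EU] := U_consistent; split.
- exact: (normconst_left_fin hU hS cS cl IU).
- by move=> th; have [rep mE] := margpar_left th; exact: (eq_rect_r (fun t => represents _ t) rep mE).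
- move=> phi mphi phi0.
  have mphiA : measurable_fun setT (fun t : pvec U => phi (margpar A t)).
    by apply: (measurableT_comp mphi); exact: measurable_margpar.
  apply: etrans (integral_prior_left hU hS cS cl IU mphi phi0).
  apply: etrans (EU _ mphiA (fun=> phi0 _)).
  apply: eq_integral => th _.
  by move: (margpar A th) (margpar_left th).2 => x ->.
Qed.

End decomposition.

Section separator.
Variables A S : {set V}.
Hypotheses (SA : S \subset A) (cS : complete e S).
Hypothesis A_consistent : consistent A.

Lemma margsum_margpar_sep (t : pvec A) : exists k, forall i, i \in cells z S ->
  margsum z A S (expR \o linpot z (ext t)) i = expR (k + linpot z (ext (margpar S t)) i)%R.
Proof.
have [a [sg ->]] := join_surj t SA cS.
by rewrite (margpar_join SA cS); exists (logsum0 z A S (ext a)) => i iS; exact: margsum_join.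
Qed.

Lemma margpar_sep (th : pvec fullT) :
  represents (th : vec R (params z e fullT)) (margpar S (margpar A th)) /\
  margpar S th = margpar S (margpar A th).
Proof.
have [_ rA _] := A_consistent.
by apply: margpar_trans (rA th) _; [exact: SA|exact: margsum_margpar_sep].
Qed.

Lemma integral_prior_sep (chi : pvec S -> \bar R) :
  measurable_fun setT chi -> (forall t, 0 <= chi t) ->
  \int[lebesgue_vec R (subfin (par A))]_t (chi (margpar S t) * (prior t)%:E) =
  \int[lebesgue_vec R (subfin (par S))]_t (chi t * (prior t)%:E).
Proof.
move=> mchi chi0; have [IA _ _] := A_consistent.
have mc : measurable_fun setT (fun t : pvec A => chi (margpar S t)).
  by apply: (measurableT_comp mchi); exact: measurable_margpar.
rewrite (integral_prior_fiber SA cS IA mc (fun=> chi0 _)).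
apply: eq_integral => sg _; congr (_ * _).
transitivity (fmean (fun t : pvec A => 1 * chi (margpar S t)) sg).
  by congr (_ * _); apply: eq_integral => a _; rewrite mul1e.
rewrite (fiber_mean_scale s alpha (phi := fun _ : pvec A => 1) (chi := chi) sg SA cS)//.
by rewrite (fiber_mean1 SA cS IA) mule1.
Qed.

Lemma consistent_sep : consistent S.
Proof.
have [IA rA EA] := A_consistent; split.
- exact: (normconst_sep_fin SA cS IA).2.
- by move=> th; have [rep mE] := margpar_sep th; exact: (eq_rect_r (fun t => represents _ t) rep mE).
- move=> chi mchi chi0.
  have mchiA : measurable_fun setT (fun t : pvec A => chi (margpar S t)).
    by apply: (measurableT_comp mchi); exact: measurable_margpar.
  apply: etrans (integral_prior_sep mchi chi0).
  apply: etrans (EA _ mchiA (fun=> chi0 _)).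
  apply: eq_integral => th _.
  by move: (margpar S th) (margpar_sep th).2 => x ->.
Qed.

End separator.

End consistent_marginals.

Section original_priors.
Variables (R : realType) (V : finType) (L : V -> finType) (z : forall v, L v).
Variable e : rel V.
Variables (s0 : vec R (params z e [set: V]%SET)) (alpha : R).
Local Notation par := (par z e).
Local Notation pvec U := (vec R (subfin (par U))).

Let s : {set V} * cell L -> R := ext (s0 : pvec [set: V]%SET).

Lemma kernel_marg_model (U : {set V}) (t : vec R (params z e U)) :
  kernel_marg (sub_param s0 U) alpha t = model_kernel z s alpha U (ext (t : pvec U)).
Proof.
apply: (etrans (kernel_margE _ _ _)); rewrite /model_kernel.
apply: (congr1 (fun r => expR (r - _))); apply: eq_bigr => x _.
have -> : sub_param s0 U = pack (par U) s :> pvec U.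
  by congr mkvec; apply/funext => y; case: y => -[D i] /= yU.
by rewrite ext_pack; case: ifPn => // xU; rewrite (ext_out (t : pvec U) xU) !mul0r.
Qed.

Lemma prior_margE (U : {set V}) (t : vec R (params z e U)) :
  prior_marg (sub_param s0 U) alpha t = conj_prior s alpha (t : pvec U).
Proof.
rewrite /prior_marg kernel_marg_model /conj_prior.
apply: (congr1 (fun c => (fine c)^-1 * _)).
by apply: eq_integral => t' _; rewrite kernel_marg_model.
Qed.

Lemma kernel_fullE (th : vec R (params z e [set: V]%SET)) :
  kernel_full s0 alpha th = model_kernel z s alpha [set: V]%SET (ext (th : pvec [set: V]%SET)).
Proof.
rewrite /kernel_full /model_kernel probE linpot0 expR0 div1r lnV ?posrE ?partition_sum_gt0// mulrN.
apply: (congr1 (fun r => expR (r - _))).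
rewrite [RHS](bigID (par [set: V]%SET))/= [X in _ + X]big1 ?addr0; last first.
  by move=> x xU; rewrite ext_out// mul0r.
rewrite (big_sub (par [set: V]%SET) (fun x => ext (th : pvec [set: V]%SET) x * s x)).
by apply: eq_bigr => x _; rewrite /s !ext_val.
Qed.

Lemma normconst_fullE :
  normconst_full s0 alpha = normconst z e s alpha [set: V]%SET.
Proof. by apply: eq_integral => th _; rewrite kernel_fullE. Qed.

Lemma prior_fullE (th : vec R (params z e [set: V]%SET)) :
  prior_full s0 alpha th = conj_prior s alpha (th : pvec [set: V]%SET).
Proof. by rewrite /prior_full kernel_fullE normconst_fullE. Qed.

End original_priors.

(** * Random tables and conditional independence *)

Section tables.
Variables (R : realType) (V : finType) (L : V -> finType) (z : forall v, L v).
Variable e : rel V.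
Implicit Types (A B S U W : {set V}).

Local Notation par := (par z e).
Local Notation pvec U := (vec R (subfin (par U))).

Lemma probE_exp U (t : pvec U) i : prob (t : vec R (params z e U)) i =
  expR (- ln (partition_sum z U (ext t)) + linpot z (ext t) i).
Proof. by rewrite probE addrC expRD expRN lnK// posrE partition_sum_gt0. Qed.

Definition mtable U (t : pvec U) : vec R (entries z U) :=
  table (t : vec R (params z e U)).

(** A table determines its parameters, so that conditioning on the table amounts
    to conditioning on the parameters. *)
Definition untable U (c : vec R (entries z U)) : pvec U :=
  pack (par U) (fun x => moebius (fun F =>
    ln (ext (c : vec R (subfin (fun i => i \in cells z U))) (restr z F x.2))) x.1).

Lemma untableK U : cancel (@mtable U) (@untable U).
Proof.
move=> t; rewrite -[RHS]extK; apply: eq_pack => x xU.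
apply: (moebius_ln_linpot (k := - ln (partition_sum z U (ext t)))) xU => i iU.
have -> : mtable t = pack (fun i => i \in cells z U)
    (fun i => prob (t : vec R (params z e U)) i) by [].
by rewrite ext_pack iU probE_exp.
Qed.

Lemma measurable_mtable U : measurable_fun setT (@mtable U).
Proof.
apply: measurable_mkvec => j; under eq_fun do rewrite probE_exp.
apply: (measurableT_comp (@measurable_expR R)); apply: measurable_funD; last first.
  by apply: measurable_linpot => x; exact: measurable_ext.
apply: measurableT_comp => //; apply: (measurableT_comp (@measurable_ln R)).
by apply: measurable_partition_sum => x; exact: measurable_ext.
Qed.

Lemma measurable_untable U : measurable_fun setT (@untable U).
Proof.
apply: measurable_pack => x _; apply: measurable_sum_cond => F _.
apply: measurable_funM => //; apply: (measurableT_comp (@measurable_ln R)).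
exact: measurable_ext.
Qed.

End tables.

Section random_tables.
Variables (R : realType) (V : finType) (L : V -> finType) (z : forall v, L v).
Variable e : rel V.
Variables (s : {set V} * cell L -> R) (alpha : R).
Implicit Types (A B S U W : {set V}).

Local Notation par := (par z e).
Local Notation pvec U := (vec R (subfin (par U))).
Local Notation fmean := (fiber_mean s alpha).
Local Notation prior := (conj_prior s alpha).
Local Notation normconst := (normconst z e s alpha).
Local Notation consistent := (consistent z e s alpha).
Local Notation fullT := [set: V]%SET.

Variables (d : measure_display) (T : measurableType d) (Pr : probability T R).
Variable th : T -> pvec fullT.
Hypotheses (mth : measurable_fun setT th)
  (th_density : has_density Pr th (fun t : pvec fullT => prior t)).

Local Open Scope ereal_scope.

Definition rtable W (w : T) : vec R (entries z W) :=
  marg_table (th w : vec R (params z e fullT)) W.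

Lemma rtableE W w : consistent W -> rtable W w = mtable (margpar W (th w)).
Proof. by move=> [_ rW _]; exact: represents_table. Qed.

Lemma expectation_consistent W (phi : pvec W -> R) : consistent W ->
  measurable_fun setT phi -> (forall t, (0 <= phi t)%R) ->
  \int[Pr]_w (phi (margpar W (th w)))%:E =
  \int[lebesgue_vec R (subfin (par W))]_t ((phi t)%:E * (prior t)%:E).
Proof.
move=> [_ _ EW] mphi phi0.
have mc : measurable_fun setT (fun t : pvec fullT => phi (margpar W t)).
  by apply: (measurableT_comp mphi); exact: measurable_margpar.
have mp : measurable_fun setT (fun t : pvec fullT => prior t).
  exact: measurable_prior.
have p0 (t : pvec fullT) : (0 <= prior t)%R by exact: prior_ge0.
have -> := expectation_density mth th_density mp p0 mc (fun=> phi0 _).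
apply: (EW (fun t => (phi t)%:E)); first exact/measurable_EFinP.
by move=> t; rewrite lee_fin.
Qed.

Lemma probability_event (E : set (pvec fullT)) : measurable E ->
  Pr (th @^-1` E) =
  \int[lebesgue_vec R (subfin (par fullT))]_t ((\1_E t)%:E * (prior t)%:E).
Proof.
move=> mE; rewrite th_density// integral_mkcond epatch_indic.
by apply: eq_integral => t _; rewrite muleC.
Qed.

Lemma measurable_table_event W (A : set (vec R (entries z W))) : measurable A ->
  measurable [set t : pvec W | A (mtable t)].
Proof.
by move=> mA; rewrite -[X in measurable X]setTI; exact: measurable_mtable.
Qed.

Lemma measurable_full_event W (A : set (vec R (entries z W))) : measurable A ->
  measurable [set t : pvec fullT | A (mtable (margpar W t))].
Proof.
move=> mA; rewrite -[X in measurable X]setTI.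
exact: (@measurable_margpar _ _ _ z e fullT W measurableT _ (measurable_table_event mA)).
Qed.

Lemma rtable_event W (A : set (vec R (entries z W))) : consistent W ->
  rtable W @^-1` A = th @^-1` [set t | A (mtable (margpar W t))].
Proof. by move=> cW; apply/seteqP; split=> w /=; rewrite rtableE. Qed.

Lemma table_law W (A : set (vec R (entries z W))) : consistent W -> measurable A ->
  Pr (rtable W @^-1` A) =
  \int[lebesgue_vec R (subfin (par W))]_(t in [set t : pvec W | A (mtable t)])
    (prior t)%:E.
Proof.
move=> cW mA; rewrite rtable_event// probability_event; last exact: measurable_full_event.
have [_ _ EW] := cW.
have := EW (fun t => (\1_[set t : pvec W | A (mtable t)] t)%:E).
move=> ->.
- by rewrite [RHS]integral_mkcond epatch_indic; apply: eq_integral => t _; rewrite muleC.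
- by apply/measurable_EFinP; apply: measurable_indic; exact: measurable_table_event.
- by move=> t; rewrite lee_fin.
Qed.

Lemma unit_fin_num (x : \bar R) : 0 <= x <= 1 -> x \is a fin_num.
Proof.
by move=> /andP[x0 x1]; rewrite ge0_fin_numE//; apply: le_lt_trans x1 (ltey _).
Qed.

Lemma cond_prob_table S (E : set (pvec fullT)) (g : pvec S -> \bar R) :
  consistent S -> measurable E -> measurable_fun setT g ->
  (forall t, 0 <= g t <= 1) ->
  (forall chi : pvec S -> \bar R, measurable_fun setT chi -> (forall t, 0 <= chi t) ->
    \int[lebesgue_vec R (subfin (par fullT))]_t
      ((\1_E t)%:E * chi (margpar S t) * (prior t)%:E) =
    \int[lebesgue_vec R (subfin (par S))]_t (chi t * g t * (prior t)%:E)) ->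
  is_cond_prob Pr (rtable S) (th @^-1` E) (fun c => fine (g (untable e c))).
Proof.
move=> cS mE mg g01 gE.
have gfin t : (fine (g t))%:E = g t by rewrite fineK// unit_fin_num.
have mfg : measurable_fun setT (fun t => fine (g t)) by exact: measurableT_comp.
split; first by apply: measurableT_comp mfg _; exact: measurable_untable.
move=> C mC; set Q := [set t : pvec S | C (mtable t)].
have mQ : measurable Q by exact: measurable_table_event.
have mIQ : measurable_fun setT (\1_Q : pvec S -> R) by exact: measurable_indic.
pose h t : R := (fine (g t) * \1_Q t)%R.
transitivity (\int[Pr]_w (h (margpar S (th w)))%:E).
  rewrite integral_mkcond epatch_indic; apply: eq_integral => w _.
  rewrite /h EFinM /= rtableE// untableK; congr (_ * _).
  rewrite !indicE; congr ((nat_of_bool _)%:R%:E).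
  by apply/idP/idP; rewrite !inE /Q /= rtableE.
rewrite (expectation_consistent cS); last 2 first.
- exact: measurable_funM.
- by move=> t; rewrite mulr_ge0// fine_ge0//; have /andP[] := g01 t.
transitivity (\int[lebesgue_vec R (subfin (par S))]_t
    ((\1_Q t)%:E * g t * (prior t)%:E)).
  by apply: eq_integral => t _; rewrite /h EFinM gfin [g t * _]muleC.
rewrite -(gE (fun t => (\1_Q t)%:E)); last 2 first.
- exact/measurable_EFinP.
- by move=> t; rewrite lee_fin.
rewrite rtable_event// -preimage_setI probability_event; last first.
  by apply: measurableI => //; exact: measurable_full_event.
apply: eq_integral => t _; congr (_ * _); rewrite indicI /= EFinM.
by [].
Qed.

Definition event_ind W (A : set (vec R (entries z W))) (t : pvec W) : \bar R :=
  (\1_[set t : pvec W | A (mtable t)] t)%:E.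

Lemma measurable_event_ind W (A : set (vec R (entries z W))) : measurable A ->
  measurable_fun setT (event_ind A).
Proof.
move=> mA; apply/measurable_EFinP; apply: measurable_indic.
exact: measurable_table_event.
Qed.

Lemma event_ind_ge0 W (A : set (vec R (entries z W))) t : 0 <= event_ind A t.
Proof. by rewrite lee_fin. Qed.

Lemma fiber_mean_event A S (A0 : set (vec R (entries z A))) (sg : pvec S) :
  S \subset A -> complete e S -> normconst A < +oo -> measurable A0 ->
  0 <= fmean (event_ind A0) sg <= 1.
Proof.
move=> SA cS IA mA0; rewrite fiber_mean_ge0 ?event_ind_ge0//; last first.
  by move=> t; exact: event_ind_ge0.
rewrite -(fiber_mean1 SA cS IA sg) lee_wpmul2l//.
  by rewrite lee_fin invr_ge0 fine_ge0// ltW// fiberconst_gt0.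
have mfib (xi : pvec A -> \bar R) : measurable_fun setT xi -> measurable_fun setT
    (fun a : vec R (subfin (resid z e A S)) => xi (join a sg) * (weight s alpha a)%:E).
  move=> mxi.
  exact: measurableT_comp (measurable_fiber s alpha mxi) (measurable_pair1 sg).
apply: ge0_le_integral => //.
- by move=> a _; rewrite mule_ge0 ?event_ind_ge0// lee_fin expR_ge0.
- by apply: mfib; exact: measurable_event_ind.
- by apply: (mfib (fun=> 1)).
- by move=> a _; rewrite lee_wpmul2r ?lee_fin ?expR_ge0// indicE.
Qed.

Lemma integral_marginal_sep A S (phi : pvec A -> \bar R) (chi : pvec S -> \bar R) :
  S \subset A -> complete e S -> consistent A ->
  measurable_fun setT phi -> (forall t, 0 <= phi t) ->
  measurable_fun setT chi -> (forall t, 0 <= chi t) ->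
  \int[lebesgue_vec R (subfin (par fullT))]_t
    (phi (margpar A t) * chi (margpar S t) * (prior t)%:E) =
  \int[lebesgue_vec R (subfin (par S))]_t (chi t * fmean phi t * (prior t)%:E).
Proof.
move=> SA cS cA mphi phi0 mchi chi0; have [IA _ EA] := cA.
pose xi (t : pvec A) := phi t * chi (margpar S t).
have mxi : measurable_fun setT xi.
  apply: emeasurable_funM => //; apply: (measurableT_comp mchi).
  exact: measurable_margpar.
have xi0 t : 0 <= xi t by rewrite mule_ge0.
transitivity (\int[lebesgue_vec R (subfin (par fullT))]_t
    (xi (margpar A t) * (prior t)%:E)).
  apply: eq_integral => t _; rewrite /xi.
  by move: (margpar S t) (margpar_sep SA cS cA t).2 => x ->.
rewrite (EA xi mxi xi0) (integral_prior_fiber SA cS IA mxi xi0).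
by apply: eq_integral => t _; rewrite (fiber_mean_scale s alpha t SA cS mphi phi0 chi0).
Qed.

(** Conditional independence given S in integral form. *)
Lemma integral_marginals_sep U A B S (phi : pvec A -> \bar R) (psi : pvec B -> \bar R)
    (chi : pvec S -> \bar R) :
  (A :|: B = U)%SET -> (A :&: B = S)%SET -> complete e S ->
  (forall D, D \in cliques e U -> D \subset A \/ D \subset B) ->
  consistent U ->
  measurable_fun setT phi -> (forall t, 0 <= phi t) ->
  measurable_fun setT psi -> (forall t, 0 <= psi t) ->
  measurable_fun setT chi -> (forall t, 0 <= chi t) ->
  \int[lebesgue_vec R (subfin (par fullT))]_t
    (phi (margpar A t) * psi (margpar B t) * chi (margpar S t) * (prior t)%:E) =
  \int[lebesgue_vec R (subfin (par S))]_t
    (chi t * (fmean phi t * fmean psi t) * (prior t)%:E).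
Proof.
move=> hU hS cS cl cU mphi phi0 mpsi psi0 mchi chi0; have [IU _ EU] := cU.
have SA : S \subset A by rewrite -hS finset.subsetIl.
have hU' : (B :|: A = U)%SET by rewrite finset.setUC.
have hS' : (B :&: A = S)%SET by rewrite finset.setIC.
have cl' D : D \in cliques e U -> D \subset B \/ D \subset A.
  by move=> /cl[|]; [right|left].
have cA := consistent_left hU hS cS cl cU.
(* The S-marginal is a function of the A-marginal, so chi can be absorbed. *)
pose xi (t : pvec A) := phi t * chi (margpar S t).
have mxi : measurable_fun setT xi.
  apply: emeasurable_funM => //; apply: (measurableT_comp mchi).
  exact: measurable_margpar.
have xi0 t : 0 <= xi t by rewrite mule_ge0.
pose F (t : pvec U) := xi (margpar A t) * psi (margpar B t).
have mF : measurable_fun setT F.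
  by apply: emeasurable_funM; [apply: (measurableT_comp mxi)|apply: (measurableT_comp mpsi)];
    exact: measurable_margpar.
have F0 t : 0 <= F t by rewrite mule_ge0.
transitivity (\int[lebesgue_vec R (subfin (par fullT))]_t
    (F (margpar U t) * (prior t)%:E)).
  apply: eq_integral => t _; rewrite /F /xi.
  move: (margpar S t) (margpar_sep SA cS cA t).2 => x ->.
  move: (margpar A t) (margpar_left hU hS cS cl cU t).2 => y ->.
  move: (margpar B t) (margpar_left hU' hS' cS cl' cU t).2 => y' ->.
  by congr (_ * _); exact: muleAC.
rewrite (EU F mF F0) (integral_prior_decomposition hU hS cS cl IU mxi xi0 mpsi psi0).
apply: eq_integral => t _; rewrite (fiber_mean_scale s alpha t SA cS mphi phi0 chi0).
by rewrite -(muleA (chi t) (fmean phi t)).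
Qed.

Lemma cond_indep_tables U A B S :
  (A :|: B = U)%SET -> (A :&: B = S)%SET -> complete e S ->
  (forall D, D \in cliques e U -> D \subset A \/ D \subset B) ->
  consistent U ->
  cond_indep Pr (rtable S) (rtable A) (rtable B).
Proof.
move=> hU hS cS cl cU A0 B0 mA0 mB0; have [IU _ _] := cU.
have SA : S \subset A by rewrite -hS finset.subsetIl.
have SB : S \subset B by rewrite -hS finset.subsetIr.
have hU' : (B :|: A = U)%SET by rewrite finset.setUC.
have hS' : (B :&: A = S)%SET by rewrite finset.setIC.
have cl' D : D \in cliques e U -> D \subset B \/ D \subset A.
  by move=> /cl[|]; [right|left].
have cA := consistent_left hU hS cS cl cU.
have cB := consistent_left hU' hS' cS cl' cU.
have cnS := consistent_sep SA cS cA.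
have [IA _ _] := cA; have [IB _ _] := cB.
have mfA : measurable_fun setT (fmean (event_ind A0) : pvec S -> \bar R).
  by apply: measurable_fiber_mean; [exact: measurable_event_ind|exact: event_ind_ge0].
have mfB : measurable_fun setT (fmean (event_ind B0) : pvec S -> \bar R).
  by apply: measurable_fiber_mean; [exact: measurable_event_ind|exact: event_ind_ge0].
have fA01 (t : pvec S) : 0 <= fmean (event_ind A0) t <= 1 by exact: fiber_mean_event.
have fB01 (t : pvec S) : 0 <= fmean (event_ind B0) t <= 1 by exact: fiber_mean_event.
exists (fun c => fine (fmean (event_ind A0) (untable e c : pvec S))),
  (fun c => fine (fmean (event_ind B0) (untable e c : pvec S))); split.
- rewrite rtable_event//; apply: cond_prob_table => //.
    exact: measurable_full_event.
  move=> chi mchi chi0.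
  exact: (integral_marginal_sep SA cS cA (measurable_event_ind mA0) (event_ind_ge0 _) mchi chi0).
- rewrite rtable_event//; apply: cond_prob_table => //.
    exact: measurable_full_event.
  move=> chi mchi chi0.
  exact: (integral_marginal_sep SB cS cB (measurable_event_ind mB0) (event_ind_ge0 _) mchi chi0).
- rewrite !rtable_event// -preimage_setI.
  rewrite (_ : (fun c => _) = (fun c => fine (fmean (event_ind A0) (untable e c : pvec S) *
      fmean (event_ind B0) (untable e c : pvec S)))); last first.
    apply/funext => c; apply/esym.
    exact: (fineM (unit_fin_num (fA01 _)) (unit_fin_num (fB01 _))).
  apply: (cond_prob_table (g := fun t => fmean (event_ind A0) t * fmean (event_ind B0) t)) => //.
  + by apply: measurableI; exact: measurable_full_event.
  + exact: emeasurable_funM.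
  + move=> t; have /andP[a0 a1] := fA01 t; have /andP[b0 b1] := fB01 t.
    rewrite mule_ge0//= -[leRHS]mule1; exact: lee_pmul.
  + move=> chi mchi chi0.
    rewrite -(integral_marginals_sep hU hS cS cl cU (measurable_event_ind mA0)
      (event_ind_ge0 _) (measurable_event_ind mB0) (event_ind_ge0 _) mchi chi0).
    apply: eq_integral => t _; congr (_ * _ * _).
    by rewrite indicI /= EFinM.
Qed.

End random_tables.

(** * Perfect enumerations and the Markov ratio *)

Section perfect_enumeration.
Variables (V : finType) (e : rel V) (k : nat) (P : 'I_k -> {set V}).
Hypothesis P_perfect : perfect_enumeration e P.

(** Indexed by natural numbers, so that the full vertex set is the case n = k. *)
Definition hist (n : nat) : {set V} := \bigcup_(m < k | (m < n)%N) P m.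

Lemma exists_component (W : {set V}) : ~~ has_complete_separator e W ->
  exists l, W \subset P l.
Proof.
move=> nW; have [_ PE _] := P_perfect.
have [U mU WU] := maxset_exists (P := fun W => ~~ has_complete_separator e W) nW.
by have [l PlU] := (PE U).1 mU; exists l; rewrite PlU.
Qed.

(** The empty set has no complete separator, so it extends to a component. *)
Lemma enumeration_gt0 : (0 < k)%N.
Proof.
have [|l _] := @exists_component finset.set0.
  apply/existsPn => C; rewrite !negb_and; apply/orP; right; apply/orP; right.
  by apply/existsPn => v; rewrite !inE andbF.
exact: leq_ltn_trans (ltn_ord l).
Qed.

(** A singleton has no complete separator, so it extends to a component. *)
Lemma hist_full : hist k = [set: V]%SET.
Proof.
apply/setP => v; rewrite inE; apply/bigcupP.
have [|l] := @exists_component [set v]%SET.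
  apply/existsPn => C; rewrite !negb_and; apply/orP; right; apply/orP; right.
  apply/existsPn => x; rewrite negb_and -implybE; apply/implyP => xv.
  apply/existsPn => y; rewrite negb_and -implybE; apply/implyP => yv.
  move: xv yv; rewrite !inE => /andP[_ /eqP ->] /andP[_ /eqP ->].
  by rewrite negbK connect0.
by rewrite finset.sub1set => vl; exists l.
Qed.

Lemma histS (l : 'I_k) : hist l.+1 = (P l :|: hist l)%SET.
Proof.
rewrite /hist (bigD1 l)//=; congr (_ :|: _)%SET; apply: eq_bigl => m.
by rewrite ltnS ltn_neqAle andbC.
Qed.

Lemma hist0 : hist 0 = finset.set0.
Proof. by rewrite /hist big_pred0. Qed.

(** Otherwise an edge of the clique would join the two sides that the separator
    separates. *)
Lemma clique_in_part (l : 'I_k) (D : {set V}) : (0 < l)%N ->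
  D \in cliques e (hist l.+1) -> D \subset P l \/ D \subset hist l.
Proof.
move=> l0; rewrite inE => /and3P[_ cD DU].
have [_ _ /(_ l l0)[_ _ sepl]] := P_perfect.
have [DP|/subsetPn[w wD wP]] := boolP (D \subset P l); [by left|right].
apply/fintype.subsetP => v vD; apply/negPn/negP => vH.
have inU x : x \in D -> x \in hist l.+1 by apply: (fintype.subsetP DU).
have vP : v \in P l by have := inU v vD; rewrite histS inE (negbTE vH) orbF.
have wH : w \in hist l by have := inU w wD; rewrite histS inE (negbTE wP).
have vS : v \notin sep P l by rewrite inE negb_and vH orbT.
have wS : w \notin sep P l by rewrite inE negb_and wP.
have /forall_inP/(_ v) := sepl; rewrite inE vS vP => /(_ isT).
move=> /forall_inP/(_ w); rewrite inE wS wH => /(_ isT) /negP; apply.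
apply: connect1; rewrite /= !inE.
have -> : (v \in history P l) = false by apply: negbTE.
have -> : w \in history P l by [].
rewrite (negbTE wP) vP/=.
have /forall_inP/(_ v vD)/forall_inP/(_ w wD) := cD.
by case: eqVneq => [vw|_ //]; move: wP; rewrite -vw vP.
Qed.

End perfect_enumeration.

(** The Markov ratio without denominators, when [h], [p] and [g] are the densities
    on histories, components and separators. *)
Lemma prod_telescope (K : comPzRingType) k (h : nat -> K) (p g : 'I_k -> K) :
  (forall l : 'I_k, l = 0%N :> nat -> h 1%N = p l) ->
  (forall l : 'I_k, (0 < l)%N -> h l.+1 * g l = p l * h l) ->
  forall n, (0 < n <= k)%N ->
  h n * \prod_(l < k | (l < n)%N && (0 < l)%N) g l = \prod_(l < k | (l < n)%N) p l.
Proof.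
move=> h1 hS [//|n] /=; elim: n => [k0|n IH nk].
  rewrite big_pred0 ?mulr1 => [|l]; last by rewrite ltnS leqn0; case: (l : nat).
  rewrite (big_pred1 (Ordinal k0)) => [|l]; last by rewrite ltnS leqn0.
  exact: h1.
pose l := Ordinal nk.
rewrite (bigD1 l) ?ltnSn//= [RHS](bigD1 l) ?ltnSn//=.
have predE (m : 'I_k) : (m < n.+2)%N && (m != l) = (m < n.+1)%N.
  by rewrite ltnS [RHS]ltn_neqAle andbC.
rewrite [X in _ = _ * X](eq_bigl _ _ predE) -IH; last exact: ltnW.
have -> : \prod_(m < k | (m < n.+2)%N && (0 < m)%N && (m != l)) g m =
    \prod_(m < k | (m < n.+1)%N && (0 < m)%N) g m.
  by apply: eq_bigl => m; rewrite andbAC predE.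
by rewrite !mulrA (hS l).
Qed.

Section markov_ratio.
Variables (R : realType) (V : finType) (L : V -> finType) (z : forall v, L v).
Variables (e : rel V) (k : nat) (P : 'I_k -> {set V}).
Hypothesis P_perfect : perfect_enumeration e P.
Variables (s : {set V} * cell L -> R) (alpha : R).

Local Notation par := (par z e).
Local Notation pvec U := (vec R (subfin (par U))).
Local Notation prior := (conj_prior s alpha).
Local Notation normconst := (normconst z e s alpha).
Local Notation consistent := (consistent z e s alpha).
Local Notation fullT := [set: V]%SET.
Local Notation hist := (hist P).

Hypothesis I_fin : (normconst fullT < +oo)%E.

Lemma sep_complete (l : 'I_k) : (0 < l)%N -> complete e (sep P l).
Proof. by have [_ _ PS] := P_perfect; move=> /PS[]. Qed.

Lemma hist_split (l : 'I_k) : (hist l :|: P l = hist l.+1)%SET.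
Proof. by rewrite histS finset.setUC. Qed.

Lemma clique_in_partC (l : 'I_k) (D : {set V}) : (0 < l)%N ->
  D \in cliques e (hist l.+1) -> D \subset hist l \/ D \subset P l.
Proof. by move=> l0 /(clique_in_part P_perfect l0)[|]; [right|left]. Qed.

(** Induction downwards from V, removing the last component at each step. *)
Lemma consistent_hist n : (0 < n <= k)%N -> consistent (hist n).
Proof.
move=> /andP[n0 nk].
have : forall j, (j < k)%N -> consistent (hist (k - j)).
  elim=> [k0|j IH jk]; first by rewrite subn0 (hist_full P_perfect); exact: consistent_setT.
  have lk : (k - j.+1 < k)%N by rewrite ltn_subrL (leq_ltn_trans _ jk).
  pose l := Ordinal lk; have l0 : (0 < l)%N by rewrite subn_gt0.
  have lS : (k - j = l.+1)%N by rewrite /= subnSK// ltnW.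
  have := IH (ltnW jk); rewrite lS => cU.
  apply: (consistent_left (hist_split l) (finset.setIC _ _) (sep_complete l0) _ cU) => D.
  exact: clique_in_partC.
move=> /(_ (k - n)%N); rewrite subKn//; apply.
by rewrite ltn_subrL n0 (leq_trans n0 nk).
Qed.

Lemma consistent_component (l : 'I_k) : consistent (P l).
Proof.
have [l0|l0] := posnP l.
  have -> : P l = hist 1 by have := histS P l; rewrite l0 hist0 finset.setU0.
  by apply: consistent_hist; rewrite (enumeration_gt0 P_perfect).
apply: (consistent_left (esym (histS P l)) erefl (sep_complete l0)).
  by move=> D; exact: clique_in_part.
by apply: consistent_hist; rewrite ltn_ord.
Qed.

Lemma consistent_separator (l : 'I_k) : (0 < l)%N -> consistent (sep P l).
Proof.
move=> l0; apply: consistent_sep (sep_complete l0) (consistent_component l).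
exact: finset.subsetIl.
Qed.

Lemma prior_gt0 W (t : pvec W) : consistent W -> 0 < prior t.
Proof.
move=> [IW _ _]; rewrite mulr_gt0 ?expR_gt0// invr_gt0 fine_gt0// IW andbT.
exact: normconst_gt0.
Qed.

Lemma prior_integral1 W : consistent W ->
  (\int[lebesgue_vec R (subfin (par W))]_t (prior t)%:E = 1)%E.
Proof.
move=> [IW _ _].
have [q q0 qE] := fine_gt0_num (normconst_gt0 z e s alpha W) IW.
transitivity (\int[lebesgue_vec R (subfin (par W))]_t (cst 1 t * (prior t)%:E))%E.
  by apply: eq_integral => t _; rewrite mul1e.
rewrite integral_prior//.
rewrite [X in (_ * X)%E](_ : _ = normconst W); last first.
  by apply: eq_integral => t _; rewrite mul1e.
by rewrite qE -EFinM mulVf// gt_eqF.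
Qed.

Lemma prior_histS (th : pvec fullT) (l : 'I_k) : (0 < l)%N ->
  prior (margpar (hist l.+1) th) * prior (margpar (sep P l) th) =
  prior (margpar (P l) th) * prior (margpar (hist l) th).
Proof.
move=> l0; have cU : consistent (hist l.+1) by apply: consistent_hist; rewrite ltn_ord.
have hU := esym (histS P l).
have cl D : D \in cliques e (hist l.+1) -> D \subset P l \/ D \subset hist l.
  exact: clique_in_part.
have [IU _ _] := cU.
have F := prior_factor (margpar (hist l.+1) th) hU erefl (sep_complete l0) cl IU.
move: (margpar (sep P l) th) (margpar_sep (finset.subsetIl _ _) (sep_complete l0)
  (consistent_component l) th).2 => x ->.
move: (margpar (P l) th) (margpar_left hU erefl (sep_complete l0) cl cU th).2 => y ->.
move: (margpar (hist l) th) (margpar_left (hist_split l) (finset.setIC _ _) (sep_complete l0)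
  (fun D => @clique_in_partC l D l0) cU th).2 => y' ->.
exact: F.
Qed.

End markov_ratio.

Theorem proposition5p1 (R : realType) (V : finType) (L : V -> finType)
    (z : forall v, L v) (e : rel V) (e_sym : symmetric e)
    (e_irr : irreflexive e) (k : nat) (P : 'I_k -> {set V})
    (P_perfect : perfect_enumeration e P)
    (s : vec R (params z e [set: V]%SET)) (alpha : R)
    (I_fin : (normconst_full s alpha < +oo)%E) :
  let S := sep P in
  let prior U := prior_marg (sub_param s U) alpha in
  let is_pdf U := (\int[lebesgue_vec R (params z e U)]_t (prior U t)%:E = 1)%E in
  [/\ forall th : vec R (params z e [set: V]%SET),
        prior_full s alpha th =
          (\prod_(l < k) prior (P l) (marg_param th (P l))) /
          (\prod_(l < k | (0 < l)%N) prior (S l) (marg_param th (S l))),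
      (forall l : 'I_k, is_pdf (P l)) /\
      (forall l : 'I_k, (0 < l)%N -> is_pdf (S l))
    & forall (d : measure_display) (T : measurableType d)
        (Pr : probability T R)
        (th : {RV Pr >-> vec R (params z e [set: V]%SET)}),
      has_density Pr th (prior_full s alpha) ->
      let p U := fun w : T => marg_table (th w) U in
      let induced U := forall A : set (vec R (entries z U)), measurable A ->
        (Pr (p U @^-1` A) =
         \int[lebesgue_vec R (params z e U)]_(t in @table R V L z e U @^-1` A)
           (prior U t)%:E)%E in
      [/\ forall l : 'I_k, induced (P l),
          forall l : 'I_k, (0 < l)%N -> induced (S l)
        & forall l : 'I_k, (0 < l)%N ->
            cond_indep Pr (p (S l)) (p (P l)) (p (history P l))]].
Proof.
  (* your proof *)
Proof.
move=> S prior is_pdf.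
pose s' := ext (s : vec R (subfin (par z e [set: V]%SET))).
have IT : (normconst z e s' alpha [set: V]%SET < +oo)%E.
  by have := I_fin; rewrite normconst_fullE.
have cP := consistent_component P_perfect IT.
have cS := consistent_separator P_perfect IT.
have priorE U (t : vec R (params z e U)) :
    prior U t = conj_prior s' alpha (t : vec R (subfin (par z e U))).
  exact: prior_margE.
have pdf U : consistent z e s' alpha U -> is_pdf U.
  move=> cU; rewrite /is_pdf -(prior_integral1 cU).
  by apply: eq_integral => t _; rewrite priorE.
split.
- move=> th.
  have [pr prD] : {pr : {set V} -> R | forall U, pr U = prior U (marg_param th U)}.
    by exists (fun U => prior U (marg_param th U)).
  have prE U : pr U = conj_prior s' alpha (margpar U (th : vec R (subfin (par z e [set: V]%SET)))).
    by rewrite prD priorE marg_param_margpar.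
  have prT : prior_full s alpha th = pr (hist P k).
    by rewrite (hist_full P_perfect) prE margpar_setT prior_fullE.
  have h1 (l : 'I_k) : l = 0%N :> nat -> pr (hist P 1) = pr (P l).
    by move=> l0; have := histS P l; rewrite l0 hist0 finset.setU0 => ->.
  have hS (l : 'I_k) : (0 < l)%N ->
      pr (hist P l.+1) * pr (S l) = pr (P l) * pr (hist P l).
    by move=> l0; rewrite !prE; exact: prior_histS.
  have kk : (0 < k <= k)%N by rewrite (enumeration_gt0 P_perfect) leqnn.
  have E := @prod_telescope _ _ (fun n => pr (hist P n)) (pr \o P) (pr \o S) h1 hS k kk.
  have prod0 : \prod_(l < k | (0 < l)%N) pr (S l) != 0.
    rewrite lt0r_neq0// prodr_gt0// => l l0; rewrite prE.
    exact: prior_gt0 (cS l l0).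
  under [X in _ / X]eq_bigr do rewrite -prD.
  under [X in X / _]eq_bigr do rewrite -prD.
  apply: (canRL (mulfK prod0)); rewrite prT.
  transitivity (\prod_(l < k | (l < k)%N) pr (P l)); last first.
    by apply: eq_bigl => l; rewrite ltn_ord.
  apply: etrans E; congr (_ * _); apply: eq_bigl => l.
  by rewrite ltn_ord.
- split=> [l|l l0]; apply: pdf; [exact: cP|exact: cS].
- move=> d T Pr th thd p induced.
  have mth : measurable_fun setT th by exact: measurable_funP.
  have thd' : has_density Pr th (fun t : vec R (subfin (par z e [set: V]%SET)) =>
      conj_prior s' alpha t).
    move=> A mA; rewrite thd//; apply: eq_integral => t _.
    by rewrite prior_fullE.
  have ind U : consistent z e s' alpha U -> induced U.
    move=> cU A mA.
    rewrite [LHS](table_law thd' cU mA).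
    by apply: eq_integral => t _; rewrite priorE.
  split=> [l|l l0|l l0]; [exact/ind/cP|exact/ind/cS|].
  apply: (cond_indep_tables mth thd' (esym (histS P l)) erefl (sep_complete P_perfect l0)).
    by move=> D; exact: clique_in_part.
  by apply: (consistent_hist P_perfect IT); rewrite ltn_ord.
Qed.
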